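(* Let $\mathcal K$ be an ideal in a right tensor $C^*$-category $\mathcal T$ and let $\mathcal J$ be an ideal in $J(\mathcal K)$. Let $\mathcal R_{\mathcal J}=\mathcal S_{\mathcal J}(\{0\})$ be the reduction ideal associated with $\mathcal J$. Putting $$\mathcal T_{\mathcal R}:=\mathcal T/\mathcal R_{\mathcal J},\qquad \mathcal K_{\mathcal R}:=\mathcal K/\mathcal R_{\mathcal J},\qquad \mathcal J_{\mathcal R}:=\mathcal J/\mathcal R_{\mathcal J},$$ we get a right tensor $C^*$-category $\mathcal T_{\mathcal R}$ with (quotient) right tensoring $\otimes1_{\mathcal R}$. The ideals $\mathcal K_{\mathcal R},\mathcal J_{\mathcal R}$ in $\mathcal T_{\mathcal R}$ are such that $\mathcal J_{\mathcal R}\subset J(\mathcal K_{\mathcal R})\cap(\ker\otimes1_{\mathcal R})^\perp$, and there is a natural isomorphism $$\mathcal O_{\mathcal T}(\mathcal K,\mathcal J)\cong\mathcal O_{\mathcal T_{\mathcal R}}(\mathcal K_{\mathcal R},\mathcal J_{\mathcal R}).$$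
   Context: $\mathbb N=\{0,1,2,\dots\}$. A $C^*$-precategory $\mathcal T$ with object set $\mathbb N$ consists of complex Banach spaces $\mathcal T(n,m)$, bilinear associative compositions $\mathcal T(n,m)\times\mathcal T(m,l)\to\mathcal T(n,l)$ with $\|ab\|\le\|a\|\|b\|$, and antilinear involutive maps $*:\mathcal T(n,m)\to\mathcal T(m,n)$ with $(ab)^*=b^*a^*$ and $\|a^*a\|=\|a\|^2$. It is a $C^*$-category if moreover it has identity morphisms (units in each $\mathcal T(n,n)$). An ideal $\mathcal K$ in $\mathcal T$ is a family of closed subspaces $\mathcal K(n,m)\subset\mathcal T(n,m)$ with $\mathcal T(n,m)\mathcal K(m,l)\subset\mathcal K(n,l)$, $\mathcal K(n,m)\mathcal T(m,l)\subset\mathcal K(n,l)$; inclusions, intersections, sums are entrywise. A right tensor $C^*$-(pre)category is such a $\mathcal T$ with linear maps $\otimes1:\mathcal T(n,m)\to\mathcal T(n+1,m+1)$ preserving composition and involution (not necessarily units); $\otimes1^k$ is the $k$-th iterate; $(\otimes1)^{-1}(\mathcal N)(n,m)=\{a\in\mathcal T(n,m):a\otimes1\in\mathcal N(n+1,m+1)\}$; $J(\mathcal K)=\mathcal K\cap(\otimes1)^{-1}(\mathcal K)$; $\ker\otimes1=(\otimes1)^{-1}(\{0\})$. For an ideal $\mathcal I$, $\mathcal I^\perp$ is the unique ideal with $\mathcal I^\perp(n,n)=\{a\in\mathcal T(n,n):a\,\mathcal I(n,n)=0\}$. $\mathcal S_{\mathcal J}(\{0\})=\overline{\bigcup_k\mathcal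 S_k}$ (entrywise) with $\mathcal S_0=\{0\}$ and $\mathcal S_k=\mathcal J\cap(\otimes1)^{-1}(\mathcal S_{k-1})+\mathcal S_{k-1}$; this ideal $\mathcal R_{\mathcal J}$ satisfies $\mathcal R_{\mathcal J}\otimes1\subset\mathcal R_{\mathcal J}$. For an ideal $\mathcal N$ with $\mathcal N\otimes1\subset\mathcal N$, $\mathcal T/\mathcal N=\{\mathcal T(n,m)/\mathcal N(n,m)\}$ carries the quotient right tensoring and $\mathcal K/\mathcal N$ denotes the image of $\mathcal K$ in $\mathcal T/\mathcal N$. A right tensor representation of $\mathcal K$ in a $C^*$-algebra $B$ is a family of linear maps $\pi_{n,m}:\mathcal K(n,m)\to B$ with $\pi_{n,m}(a)^*=\pi_{m,n}(a^* )$ and $\pi_{n,m}(a)\pi_{m+k,l}(b)=\pi_{n+k,l}((a\otimes1^k)b)$ for $a\in\mathcal K(n,m)$, $b\in\mathcal K(m+k,l)$; it is coisometric on $\mathcal J\subset J(\mathcal K)$ if $\pi_{n,m}(a)=\pi_{n+1,m+1}(a\otimes1)$ for $a\in\mathcal J(n,m)$. $\mathcal O_{\mathcal T}(\mathcal K,\mathcal J)$ is the universal $C^*$-algebra generated by the image of a universal right tensor representation of $\mathcal K$ coisometric on $\mathcal J$. *)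

(* Defs.v *)
From HB Require Import structures.
From mathcomp Require Import all_boot all_order all_algebra.
From mathcomp Require Import generic_quotient complex.
From mathcomp Require Import ring.
From mathcomp Require Import boolp classical_sets functions reals topology normedtype sequences.

Set Implicit Arguments.
Unset Strict Implicit.
Unset Printing Implicit Defensive.
Import Order.TTheory GRing.Theory Num.Theory numFieldNormedType.Exports.
Local Open Scope classical_set_scope.
Local Open Scope complex_scope.
Local Open Scope quotient_scope.
Local Open Scope ring_scope.

Definition is_subspace (R : realType) (V : lmodType R[i]) (A : set V) : Prop :=
  A 0 /\ forall (c : R[i]) u v, A u -> A v -> A (c *: u + v).

Record closed_subspace (R : realType) (V : completeNormedModType R[i]) :=
  ClosedSubspace {
    subspace_set :> set V;
    subspaceP : is_subspace subspace_set;
    subspace_closed : closed subspace_set }.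

Section quotient_space.
Variables (R : realType) (V : completeNormedModType R[i]).
Variable M : closed_subspace V.
Local Notation N := (subspace_set M).

Definition quotient_equiv (u v : V) : bool := `[< N (u - v) >].

Lemma quotient_equiv_refl : reflexive quotient_equiv.
Proof. by move=> u; apply/asboolP; rewrite subrr; case: (subspaceP M). Qed.

Let NZ c u : N u -> N (c *: u).
Proof.
move=> Nu; have [N0 ND] := subspaceP M.
by rewrite -[_ *: _]addr0; exact: ND.
Qed.

Let NB u v : N u -> N v -> N (u - v).
Proof.
move=> Nu Nv; have [N0 ND] := subspaceP M.
by rewrite addrC -scaleN1r; exact: ND.
Qed.

Let NN u : N u -> N (- u).
Proof. by move=> Nu; rewrite -scaleN1r; exact: NZ. Qed.

Lemma quotient_equiv_sym : symmetric quotient_equiv.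
Proof.
by move=> u v; apply/asboolP/asboolP => /NN; rewrite opprB.
Qed.

Lemma quotient_equiv_trans : transitive quotient_equiv.
Proof.
move=> v u w /asboolP uv /asboolP /NN vw; apply/asboolP.
by have := NB uv vw; rewrite opprK addrA subrK.
Qed.

Canonical quotient_equivRel := EquivRel quotient_equiv
  quotient_equiv_refl quotient_equiv_sym quotient_equiv_trans.

Definition quotient_space := {eq_quot quotient_equiv}.
HB.instance Definition _ := Choice.on quotient_space.
HB.instance Definition _ := Quotient.on quotient_space.
HB.instance Definition _ := EqQuotient.on quotient_space.

Local Notation Q := quotient_space.
Definition quotient_map (u : V) : Q := \pi_Q u.
Local Notation p := quotient_map.

Lemma quotient_mapW (P : Q -> Prop) : (forall u, P (p u)) -> forall x, P x.
Proof. by move=> Pp x; rewrite -[x]reprK; exact: Pp. Qed.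

Lemma quotient_eqP u v : reflect (N (u - v)) (p u == p v).
Proof.
apply: (iffP eqP) => [uv|Nuv]; last by apply/eqmodP/asboolP.
by move/eqmodP: uv => /asboolP.
Qed.

Definition quotient_zero : Q := p 0.
Definition quotient_opp (x : Q) : Q := p (- repr x).
Definition quotient_add (x y : Q) : Q := p (repr x + repr y).
Definition quotient_scale (c : R[i]) (x : Q) : Q := p (c *: repr x).

Let repr_p u : N (repr (p u) - u).
Proof. by apply/quotient_eqP; rewrite /quotient_map reprK. Qed.

Let p_opp u : quotient_opp (p u) = p (- u).
Proof.
by apply/eqP/quotient_eqP; rewrite opprK addrC -opprB; exact/NN/repr_p.
Qed.

Let p_add u v : quotient_add (p u) (p v) = p (u + v).
Proof.
apply/eqP/quotient_eqP; rewrite opprD addrACA.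
by have := NB (repr_p u) (NN (repr_p v)); rewrite opprK.
Qed.

Let p_scale c u : quotient_scale c (p u) = p (c *: u).
Proof. by apply/eqP/quotient_eqP; rewrite -scalerBr; exact/NZ/repr_p. Qed.

Let addA : associative quotient_add.
Proof. by elim/quotient_mapW=> u; elim/quotient_mapW=> v; elim/quotient_mapW=> w; rewrite (p_add v w) (p_add u v) !p_add addrA. Qed.
Let addC : commutative quotient_add.
Proof. by elim/quotient_mapW=> u; elim/quotient_mapW=> v; rewrite !p_add addrC. Qed.
Let add0 : left_id quotient_zero quotient_add.
Proof. by elim/quotient_mapW=> u; rewrite p_add add0r. Qed.
Let addN : left_inverse quotient_zero quotient_opp quotient_add.
Proof. by elim/quotient_mapW=> u; rewrite p_opp (p_add (- u) u) addNr. Qed.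
HB.instance Definition _ := GRing.isZmodule.Build Q addA addC add0 addN.

Lemma quotient_mapD u v : p (u + v) = p u + p v. Proof. exact/esym/p_add. Qed.

Let scaleA c d x : quotient_scale c (quotient_scale d x) = quotient_scale (c * d) x.
Proof. by elim/quotient_mapW: x => u; rewrite !p_scale scalerA. Qed.
Let scale1 : left_id 1 quotient_scale.
Proof. by elim/quotient_mapW=> u; rewrite p_scale scale1r. Qed.
Let scaleDr : right_distributive quotient_scale +%R.
Proof.
by move=> c; elim/quotient_mapW=> u; elim/quotient_mapW=> v; rewrite -quotient_mapD !p_scale -quotient_mapD scalerDr.
Qed.
Let scaleDl x : {morph quotient_scale^~ x : c d / c + d}.
Proof. by elim/quotient_mapW: x => u c d; rewrite !p_scale -quotient_mapD scalerDl. Qed.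
HB.instance Definition _ :=
  GRing.Zmodule_isLmodule.Build R[i] Q scaleA scale1 scaleDr scaleDl.

Lemma quotient_mapN u : p (- u) = - p u. Proof. exact/esym/p_opp. Qed.
Lemma quotient_mapB u v : p (u - v) = p u - p v.
Proof. by rewrite quotient_mapD quotient_mapN. Qed.
Lemma quotient_mapZ c u : p (c *: u) = c *: p u. Proof. exact/esym/p_scale. Qed.

(* the norm of V takes values in R[i], where infima are not available *)
Definition quotient_norm (x : Q) : R[i] :=
  (inf [set complex.Re `|u| | u in [set u : V | p u = x]])%:C.

Let normE (u : V) : `|u| = (complex.Re `|u|)%:C.
Proof. by rewrite RRe_real // ger0_real. Qed.

Let lb0 (x : Q) : lbound [set complex.Re `|u| | u in [set u : V | p u = x]] 0.
Proof. by move=> _ [u _ <-]; rewrite -ler0c -normE. Qed.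

Let norms_n0 (x : Q) : [set complex.Re `|u| | u in [set u : V | p u = x]] !=set0.
Proof. by exists (complex.Re `|repr x|); exists (repr x) => //=; rewrite /quotient_map reprK. Qed.

Lemma quotient_norm_le u : quotient_norm (p u) <= `|u|.
Proof.
rewrite normE lecR; apply: ge_inf; last by exists u.
by exists 0; exact: lb0.
Qed.

Lemma quotient_norm_lt x (e : R) : quotient_norm x < e%:C ->
  exists2 u, p u = x & `|u| < e%:C.
Proof.
rewrite ltcR => /inf_lt => /(_ (norms_n0 x))[_ [u /= ux <-] ue].
by exists u => //; rewrite normE ltcR.
Qed.

Let quotient_norm_ge0 x : 0 <= quotient_norm x.
Proof. by rewrite ler0c; apply: lb_le_inf; [exact: norms_n0|exact: lb0]. Qed.

Let le_addeps (x y : R[i]) : 0 <= x -> 0 <= y ->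
  (forall e : R, 0 < e -> x <= y + e%:C) -> x <= y.
Proof.
move=> x0 y0 h.
have xE : x = (complex.Re x)%:C by rewrite RRe_real // ger0_real.
have yE : y = (complex.Re y)%:C by rewrite RRe_real // ger0_real.
rewrite xE yE lecR; apply/ler_addgt0Pr => e e0.
by rewrite -lecR rmorphD /= -xE -yE; exact: h.
Qed.

Let quotient_near x (e : R) : 0 < e ->
  exists2 u, p u = x & `|u| < quotient_norm x + e%:C.
Proof.
move=> e0; rewrite /quotient_norm -rmorphD /=; apply: quotient_norm_lt.
by rewrite ltcR ltrDl.
Qed.

Let normD x y : quotient_norm (x + y) <= quotient_norm x + quotient_norm y.
Proof.
apply: le_addeps => // [|e e0]; first exact: addr_ge0.
have e20 : 0 < e / 2 by rewrite divr_gt0.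
have [u <- ue] := quotient_near x e20; have [v <- ve] := quotient_near y e20.
rewrite -quotient_mapD (le_trans (quotient_norm_le _))// (le_trans (ler_normD _ _))//.
rewrite (splitr e) rmorphD /= addrACA; apply: lerD; exact: ltW.
Qed.

Let normZ_le c x : quotient_norm (c *: x) <= `|c| * quotient_norm x.
Proof.
have [->|c0] := eqVneq c 0.
  rewrite normr0 mul0r scale0r.
  by apply: (le_trans (quotient_norm_le 0)); rewrite normr0.
apply: le_addeps => // [|e e0]; first exact: mulr_ge0.
have cE : `|c| = (complex.Re `|c|)%:C by rewrite RRe_real // ger0_real.
have c0' : 0 < complex.Re `|c| by rewrite -ltcR -cE normr_gt0.
have [u <- ue] := quotient_near x (divr_gt0 e0 c0').
rewrite -quotient_mapZ (le_trans (quotient_norm_le _))// normrZ.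
have -> : e%:C = `|c| * (e / complex.Re `|c|)%:C.
  by rewrite [in RHS]cE -rmorphM /= mulrC divfK // gt_eqF.
by rewrite -mulrDr ler_pM2l ?normr_gt0// ltW.
Qed.

Let normZ c x : quotient_norm (c *: x) = `|c| * quotient_norm x.
Proof.
apply/eqP; rewrite eq_le normZ_le /=.
have [->|c0] := eqVneq c 0; first by rewrite normr0 mul0r.
rewrite -ler_pdivlMl ?normr_gt0// -normfV.
by apply: le_trans (normZ_le _ _); rewrite scalerA mulVf// scale1r.
Qed.

Let norm_eq0 x : quotient_norm x = 0 -> x = 0.
Proof.
elim/quotient_mapW: x => u u0; change (p u = p 0); apply/eqP/quotient_eqP.
rewrite subr0; apply: (@subspace_closed _ _ M u) => B /nbhs_ballP[e /= e0 eB].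
have eE : e = (complex.Re e)%:C by rewrite RRe_real // gtr0_real.
have [v vu ve] : exists2 v, p v = p u & `|v| < (complex.Re e)%:C.
  by apply: quotient_norm_lt; rewrite -eE u0.
exists (u - v); split; first by apply/quotient_eqP; rewrite vu.
by apply: eB; rewrite -ball_normE /= opprB addrC subrK eE.
Qed.

HB.instance Definition _ :=
  @Lmodule_isNormed.Build R[i] Q quotient_norm normD normZ norm_eq0.

Let posE (e : R[i]) : 0 < e -> e = (complex.Re e)%:C.
Proof. by move=> e0; rewrite RRe_real // gtr0_real. Qed.

Let quotient_norm_map u : `|p u| <= `|u|.
Proof. exact: quotient_norm_le. Qed.

Let lift_step (d : R) x y u : p u = x -> `|y - x| < d%:C ->
  exists2 v, p v = y & `|v - u| < d%:C.
Proof.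
move=> ux /quotient_norm_lt[w wyx wd].
exists (u + w); first by rewrite quotient_mapD ux wyx addrC subrK.
by rewrite addrAC subrr add0r.
Qed.

Let h (k : nat) : R := 2^-1 ^+ k.

Let h0 k : 0 < h k. Proof. by rewrite /h exprn_gt0 // invr_gt0. Qed.
Let hS k : h k.+1 = h k / 2. Proof. by rewrite /h exprSr. Qed.

Let h_small (e : R) : 0 < e -> exists k, h k < e.
Proof.
move=> e0; exists (Num.bound e^-1).
rewrite /h exprVn invf_plt ?posrE ?exprn_gt0//; exact: upper_nthrootP.
Qed.

Lemma quotient_complete (F : set_system Q) : ProperFilter F -> cauchy F -> cvg F.
Proof.
move=> FF /cauchyP Fc.
have hC0 k : 0 < (h k)%:C by rewrite ltcR.
have /choice[x xF] : forall k, exists x, F (ball x (h k)%:C).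
  by move=> k; exact: Fc.
have xS k : `|x k.+1 - x k| < (3 * (h k - h k.+1))%:C.
  have [y [y1 y2]] := filter_ex (filterI (xF k.+1) (xF k)).
  move: y1 y2; rewrite -!ball_normE /= => y1 y2.
  rewrite -(subrK y (x k.+1)) -addrA (le_lt_trans (ler_normD _ _))//.
  rewrite [X in _ < X%:C](_ : _ = h k.+1 + h k); last by rewrite hS; field.
  by rewrite rmorphD /= ltrD // distrC.
have [v [vx vS]] : exists v, (forall k, p (v k) = x k) /\
    forall k, `|v k.+1 - v k| < (3 * (h k - h k.+1))%:C.
  have step k (u : {u | p u = x k}) : {w : {w | p w = x k.+1} |
      `|sval w - sval u| < (3 * (h k - h k.+1))%:C}.
    apply: cid; have [w wx wu] := lift_step (svalP u) (xS k).
    by exists (exist _ w wx).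
  have v0 : {u | p u = x 0%N} by exists (repr (x 0%N)); rewrite /quotient_map reprK.
  pose fix v k : {u | p u = x k} :=
    if k is k'.+1 then sval (step k' (v k')) else v0.
  exists (fun k => sval (v k)); split => k; first exact: (svalP (v k)).
  exact: (svalP (step k (v k))).
have vC k m : `|v (k + m)%N - v k| <= (3 * (h k - h (k + m)%N))%:C.
  elim: m => [|m IH]; first by rewrite addn0 !subrr mulr0 normr0.
  rewrite addnS -(subrK (v (k + m)%N) (v (k + m).+1)) -addrA.
  rewrite (le_trans (ler_normD _ _))//.
  rewrite [X in _ <= X%:C](_ : _ = 3 * (h (k + m)%N - h (k + m).+1) +
    3 * (h k - h (k + m)%N)); last by ring.
  by rewrite rmorphD /= lerD // ltW.
have vC' k m : (k <= m)%N -> `|v m - v k| <= (3 * h k)%:C.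
  move=> km; rewrite -(subnKC km) (le_trans (vC _ _))// lecR ler_pM2l//.
  by rewrite gerBl ltW.
have : cvg (v @ \oo).
  apply: cauchy_cvg; apply/cauchyP => e e0.
  have e0' : 0 < complex.Re e / 3 by rewrite divr_gt0// -ltcR -posE.
  have [k ke] := h_small e0'.
  exists (v k); exists k => // m /= km.
  rewrite -ball_normE /= distrC (le_lt_trans (vC' _ _ km))//.
  by rewrite (posE e0) ltcR mulrC -ltr_pdivlMr.
move=> /cvg_ex[w vw]; apply/cvg_ex; exists (p w).
apply/cvgrPdist_lt => e e0.
have e0' : 0 < complex.Re e / 5 by rewrite divr_gt0// -ltcR -posE.
have [k ke] := h_small e0'.
have [m _ /(_ (maxn m k) (leq_maxl _ _)) /= wm] :=
  (proj1 (cvgrPdist_lt _ _) vw) _ (hC0 k).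
have wk : `|w - v k| <= (4 * h k)%:C.
  rewrite -(subrK (v (maxn m k)) w) -addrA (le_trans (ler_normD _ _))//.
  rewrite (_ : 4 * h k = h k + 3 * h k); last by field.
  rewrite rmorphD /= lerD //; first exact: ltW.
  exact/vC'/leq_maxr.
apply: filterS (xF k) => y; rewrite -ball_normE /= => yk.
rewrite -(subrK (x k) (p w)) -addrA (le_lt_trans (ler_normD _ _))//.
rewrite -vx -quotient_mapB (le_lt_trans (lerD (quotient_norm_map _) (lexx _)))//.
rewrite vx (posE e0) (lt_trans (y := (5 * h k)%:C))//.
  rewrite (_ : 5 * h k = 4 * h k + h k); last by field.
  by rewrite rmorphD /= ler_ltD.
by rewrite ltcR mulrC -ltr_pdivlMr.
Qed.

HB.instance Definition _ := Uniform_isComplete.Build Q quotient_complete.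

End quotient_space.

Record tensor_data (R : realType) := TensorData {
  hom :> nat -> nat -> completeNormedModType R[i];
  comp : forall n m l, hom n m -> hom m l -> hom n l;
  star : forall n m, hom n m -> hom m n;
  tens : forall n m, hom n m -> hom n.+1 m.+1 }.

Arguments comp {R t n m l}.
Arguments star {R t n m}.
Arguments tens {R t n m}.

Notation "a ** b" := (comp a b) (at level 40, left associativity) : ring_scope.

Record is_cstar_precategory (R : realType) (T : tensor_data R) : Prop := {
  comp_linearl : forall n m l (c : R[i]) (a a' : T n m) (b : T m l),
    (c *: a + a') ** b = c *: (a ** b) + a' ** b;
  comp_linearr : forall n m l (c : R[i]) (a : T n m) (b b' : T m l),
    a ** (c *: b + b') = c *: (a ** b) + a ** b';
  compA : forall n m l k (a : T n m) (b : T m l) (d : T l k),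
    a ** (b ** d) = a ** b ** d;
  comp_norm : forall n m l (a : T n m) (b : T m l), `|a ** b| <= `|a| * `|b|;
  star_antilinear : forall n m (c : R[i]) (a a' : T n m),
    star (c *: a + a') = c^*%C *: star a + star a';
  starK : forall n m (a : T n m), star (star a) = a;
  star_comp : forall n m l (a : T n m) (b : T m l),
    star (a ** b) = star b ** star a;
  cstar_identity : forall n m (a : T n m), `|star a ** a| = `|a| ^+ 2 }.

Definition has_identities (R : realType) (T : tensor_data R) : Prop :=
  forall n, exists e : T n n,
    (forall m (a : T n m), e ** a = a) /\ (forall m (a : T m n), a ** e = a).

Record is_right_tensoring (R : realType) (T : tensor_data R) : Prop := {
  tens_linear : forall n m (c : R[i]) (a b : T n m),
    tens (c *: a + b) = c *: tens a + tens b;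
  tens_comp : forall n m l (a : T n m) (b : T m l),
    tens (a ** b) = tens a ** tens b;
  tens_star : forall n m (a : T n m), tens (star a) = star (tens a) }.

Record is_right_tensor_cstar_category (R : realType) (T : tensor_data R) : Prop := {
  category_precategory : is_cstar_precategory T;
  category_identities : has_identities T;
  category_tensoring : is_right_tensoring T }.

(* the source of the k-th iterate is written k + n, which reduces by recursion
   on k, so that no cast is needed *)
Fixpoint tens_iter (R : realType) (T : tensor_data R) (n m k : nat) (a : T n m) :
    T (k + n)%N (k + m)%N :=
  if k is k'.+1 then tens (tens_iter k' a) else a.

Section families.
Variables (R : realType) (T : tensor_data R).

Definition hom_family := forall n m, set (T n m).
Implicit Types F G I J K N P : hom_family.

Definition subfamily F G : Prop := forall n m, F n m `<=` G n m.

Definition family_zero : hom_family := fun n m => [set 0].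

Definition family_cap F G : hom_family := fun n m => F n m `&` G n m.

Definition family_sum F G : hom_family :=
  fun n m => [set a + b | a in F n m & b in G n m].

Definition tens_preimage N : hom_family := fun n m => [set a | N n.+1 m.+1 (tens a)].

Record is_ideal K : Prop := {
  ideal_subspace : forall n m, is_subspace (K n m);
  ideal_closed : forall n m, closed (K n m);
  ideal_compl : forall n m l (a : T n m) (b : T m l), K m l b -> K n l (a ** b);
  ideal_compr : forall n m l (a : T n m) (b : T m l), K n m a -> K n l (a ** b) }.

Definition tensor_part K : hom_family := family_cap K (tens_preimage K).

Definition ker_tens : hom_family := tens_preimage family_zero.

Definition is_annihilator I P : Prop :=
  is_ideal P /\
  forall n, P n n = [set a | forall b, I n n b -> a ** b = 0].

(* over an ideal of a C*-precategory exactly one family satisfies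
   is_annihilator, and the union below is that family *)
Definition annihilator I : hom_family :=
  fun n m => [set a | exists2 P, is_annihilator I P & P n m a].

Fixpoint reduction_step J (k : nat) : hom_family :=
  if k is k'.+1 then
    family_sum (family_cap J (tens_preimage (reduction_step J k')))
               (reduction_step J k')
  else family_zero.

Arguments reduction_step : clear implicits.

Definition reduction J : hom_family :=
  fun n m => closure (\bigcup_k reduction_step J k n m).

Arguments reduction : clear implicits.

Section reduction_subspace.
Hypothesis hT : is_right_tensor_cstar_category T.
Variables (J : hom_family) (hJ : is_ideal J).

Let tens0 n m : tens (0 : T n m) = 0.
Proof.
have /= := tens_linear (category_tensoring hT) (-1) (0 : T n m) 0.
by rewrite scaler0 addr0 scaleN1r addNr.
Qed.

Lemma reduction_step_subspace k n m : is_subspace (reduction_step J k n m).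
Proof.
elim: k n m => [|k IH] n m /=.
  by split=> // c u v -> ->; rewrite scaler0 addr0.
have [J0 JD] := ideal_subspace hJ n m.
have [S0 SD] := IH n m; have [S0' SD'] := IH n.+1 m.+1.
split.
  exists 0; last by exists 0 => //; rewrite addr0.
  by split => //; rewrite /tens_preimage /= tens0.
move=> c _ _ [a [Ja Sa] [b Sb <-]] [a' [Ja' Sa'] [b' Sb' <-]].
exists (c *: a + a'); last by exists (c *: b + b');
  [exact: SD|rewrite scalerDr addrACA].
split; first exact: JD.
rewrite /tens_preimage /= (tens_linear (category_tensoring hT)).
exact: SD'.
Qed.

Lemma reduction_step_le k l n m : (k <= l)%N ->
  reduction_step J k n m `<=` reduction_step J l n m.
Proof.
move/subnKC <-; elim: (l - k)%N => [|i IH]; first by rewrite addn0.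
rewrite addnS => a /IH Sa; exists 0; last by exists a => //; rewrite add0r.
split; first by case: (ideal_subspace hJ n m).
by rewrite /tens_preimage /= tens0; case: (reduction_step_subspace (k + i) n.+1 m.+1).
Qed.

Lemma reduction_subspaceP n m : is_subspace (reduction J n m).
Proof.
split.
  by apply: subset_closure; exists 0%N.
move=> c u v ru rv.
suff h (e : R[i]) : 0 < e -> exists2 w,
    (\bigcup_k reduction_step J k n m) w & `|(c *: u + v) - w| < e.
  by move=> B /nbhs_ballP[e /= /h[w Sw we] eB]; exists w; split => //;
    apply: eB; rewrite -ball_normE.
have near_pt x (d : R[i]) : reduction J n m x -> 0 < d ->
    exists2 y, (\bigcup_k reduction_step J k n m) y & `|x - y| < d.
  move=> rx d0; have [y [Sy yd]] := rx _ (nbhsx_ballx x _ d0).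
  by exists y => //; move: yd; rewrite -ball_normE.
move=> e0; have e2 : 0 < e / 2 by rewrite divr_gt0.
have c1 : 0 < `|c| + 1 by rewrite ltr_wpDl.
have [u' [k _ Su'] uu'] := near_pt u _ ru (divr_gt0 e2 c1).
have [v' [l _ Sv'] vv'] := near_pt v _ rv e2.
exists (c *: u' + v').
  exists (maxn k l) => //.
  have [_] := reduction_step_subspace (maxn k l) n m; apply.
    exact: reduction_step_le (leq_maxl _ _) _ Su'.
  exact: reduction_step_le (leq_maxr _ _) _ Sv'.
rewrite opprD addrACA -scalerBr (le_lt_trans (ler_normD _ _))//.
rewrite (splitr e) ler_ltD// normrZ.
rewrite (le_trans (y := (`|c| + 1) * `|u - u'|))//.
  by rewrite ler_wpM2r// lerDl.
by rewrite mulrC -ler_pdivlMr// ltW.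
Qed.

Definition reduction_ideal n m : closed_subspace (T n m) :=
  ClosedSubspace (reduction_subspaceP n m) (@closed_closure _ _).

End reduction_subspace.

End families.

Arguments family_zero {R T} n m.
Arguments family_cap {R T} F G n m.
Arguments family_sum {R T} F G n m.
Arguments tens_preimage {R T} N n m.
Arguments tensor_part {R T} K n m.
Arguments ker_tens {R} T n m.
Arguments annihilator {R T} I n m.
Arguments reduction_step {R T} J k n m.
Arguments reduction {R T} J n m.

Section quotient_category.
Variables (R : realType) (T : tensor_data R).
Variable N : forall n m, closed_subspace (T n m).

(* operations on chosen representatives; they do not depend on the choice as
   soon as N is an ideal with tens N inside N *)
Definition quotient_data : tensor_data R := {|
  hom := fun n m => quotient_space (N n m);
  comp := fun n m l x y => quotient_map (N n l) (repr x ** repr y);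
  star := fun n m x => quotient_map (N m n) (star (repr x));
  tens := fun n m x => quotient_map (N n.+1 m.+1) (tens (repr x)) |}.

Definition quotient_functor n m (a : T n m) : quotient_data n m :=
  quotient_map (N n m) a.

Definition quotient_family (K : hom_family T) : hom_family quotient_data :=
  fun n m => [set quotient_functor a | a in K n m].

End quotient_category.

Arguments quotient_functor {R T} N n m a.
Arguments quotient_family {R T} N K n m.

Record is_right_tensor_functor (R : realType) (T T' : tensor_data R)
    (q : forall n m, T n m -> T' n m) : Prop := {
  functor_linear : forall n m (c : R[i]) (a b : T n m),
    q n m (c *: a + b) = c *: q n m a + q n m b;
  functor_comp : forall n m l (a : T n m) (b : T m l),
    q n l (a ** b) = q n m a ** q m l b;
  functor_star : forall n m (a : T n m), q m n (star a) = star (q n m a);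
  functor_tens : forall n m (a : T n m),
    q n.+1 m.+1 (tens a) = tens (q n m a) }.

Record cstar_algebra (R : realType) := CstarAlgebra {
  carrier :> completeNormedModType R[i];
  amul : carrier -> carrier -> carrier;
  astar : carrier -> carrier;
  amul_linearl : forall (c : R[i]) x x' y,
    amul (c *: x + x') y = c *: amul x y + amul x' y;
  amul_linearr : forall (c : R[i]) x y y',
    amul x (c *: y + y') = c *: amul x y + amul x y';
  amulA : forall x y z, amul x (amul y z) = amul (amul x y) z;
  amul_norm : forall x y, `|amul x y| <= `|x| * `|y|;
  astar_antilinear : forall (c : R[i]) x y,
    astar (c *: x + y) = c^*%C *: astar x + astar y;
  astarK : forall x, astar (astar x) = x;
  astar_mul : forall x y, astar (amul x y) = amul (astar y) (astar x);
  acstar_identity : forall x, `|amul (astar x) x| = `|x| ^+ 2 }.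

Arguments amul {R _}.
Arguments astar {R _}.

Record is_star_hom (R : realType) (A B : cstar_algebra R) (f : A -> B) : Prop := {
  hom_linear : forall (c : R[i]) x y, f (c *: x + y) = c *: f x + f y;
  hom_mul : forall x y, f (amul x y) = amul (f x) (f y);
  hom_star : forall x, f (astar x) = astar (f x) }.

Record is_cstar_subalgebra (R : realType) (B : cstar_algebra R) (S : set B) :
    Prop := {
  subalgebra_subspace : is_subspace S;
  subalgebra_closed : closed S;
  subalgebra_mul : forall x y, S x -> S y -> S (amul x y);
  subalgebra_star : forall x, S x -> S (astar x) }.

(* pi is a family of maps on K; its values outside K play no role *)
Record is_representation (R : realType) (T : tensor_data R) (K : hom_family T)
    (B : cstar_algebra R) (pi : forall n m, T n m -> B) : Prop := {
  rep_linear : forall n m (c : R[i]) (a b : T n m), K n m a -> K n m b ->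
    pi n m (c *: a + b) = c *: pi n m a + pi n m b;
  rep_star : forall n m (a : T n m), K n m a ->
    astar (pi n m a) = pi m n (star a);
  rep_mul : forall n m k l (a : T n m) (b : T (k + m)%N l),
    K n m a -> K (k + m)%N l b ->
    amul (pi n m a) (pi (k + m)%N l b) = pi (k + n)%N l (tens_iter k a ** b) }.

Definition is_coisometric (R : realType) (T : tensor_data R) (J : hom_family T)
    (B : cstar_algebra R) (pi : forall n m, T n m -> B) : Prop :=
  forall n m (a : T n m), J n m a -> pi n m a = pi n.+1 m.+1 (tens a).

(* (B, i) is a model of the C*-algebra O_T(K, J) with its canonical
   representation; such a model is determined up to a unique isomorphism *)
Record is_universal_algebra (R : realType) (T : tensor_data R)
    (K J : hom_family T) (B : cstar_algebra R) (i : forall n m, T n m -> B) : Prop := {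
  universal_rep : is_representation K i;
  universal_coisometric : is_coisometric J i;
  universal_generated : forall S : set B, is_cstar_subalgebra S ->
    (forall n m (a : T n m), K n m a -> S (i n m a)) -> S = setT;
  universal_factor : forall (D : cstar_algebra R) (pi : forall n m, T n m -> D),
    is_representation K pi -> is_coisometric J pi ->
    exists2 f : B -> D, is_star_hom f &
      forall n m (a : T n m), K n m a -> f (i n m a) = pi n m a }.

(* Main.v *)
(** Quotients are C*-categories because closed ideals have approximate units: for x
    self-adjoint, p = (1 + (x / 2 eps)^2)^-1 is a contraction with |x p| <= eps and 1 - p in
    the ideal generated by x.
    The reduction steps S_k are increasing and S_k tens 1 lies in S_k, so that
    S_(k+1) = J cap tens^-1(S_k) is a closed ideal.  The crucial point is that
    J cap tens^-1(R_J) lies in R_J.  For a positive x in J with x tens 1 in R_J, the positive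
    part of x - eps is within 2 eps of x, and every *-homomorphism mapping x to an element of
    norm at most eps kills it; applied to T -> T / J and to the tensoring followed by
    T -> T / S_k, where x tens 1 is eps-close to S_k, this puts the positive part in S_(k+1).
    Hence J_R is orthogonal to the kernel of the tensoring.  Finally a coisometric
    representation kills each S_k by induction and hence, being contractive, kills R_J, so it
    factors through the quotient and both universal properties agree.
    Norm estimates come from the square root of 1 - h, obtained by iterating
    k -> (h + k^2) / 2, and from |c|^2 <= |c^2 + r^2| for commuting self-adjoint c, r; no
    spectral theory is involved. *)
Require Import Defs.
From mathcomp Require Import all_boot all_order all_algebra.
From mathcomp Require Import complex ring lra.
From mathcomp Require Import boolp classical_sets reals topology normedtype.
Local Open Scope classical_set_scope.
Local Open Scope ring_scope.

Set Implicit Arguments.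
Unset Strict Implicit.
Unset Printing Implicit Defensive.
Import Order.TTheory GRing.Theory Num.Theory numFieldNormedType.Exports.

(** * Real-valued norms, closures and limits of iterations in Banach spaces *)

Section real_norm.
Local Open Scope complex_scope.
Variable R : realType.
Implicit Types V : completeNormedModType R[i].

(* the norm of a [completeNormedModType R[i]] is [R[i]]-valued *)
Definition rnorm V (x : V) : R := complex.Re `|x|.

Lemma rnormE V (x : V) : `|x| = (rnorm x)%:C.
Proof. by rewrite /rnorm RRe_real // ger0_real. Qed.

Lemma rnorm_ge0 V (x : V) : 0 <= rnorm x.
Proof. by rewrite -ler0c -rnormE. Qed.

Lemma rnorm0 V : rnorm (0 : V) = 0.
Proof. by rewrite /rnorm normr0. Qed.

Lemma rnorm_eq0 V (x : V) : rnorm x = 0 -> x = 0.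
Proof. by move=> x0; apply/eqP; rewrite -normr_eq0 rnormE x0. Qed.

Lemma rnormD V (x y : V) : rnorm (x + y) <= rnorm x + rnorm y.
Proof. by rewrite -lecR rmorphD /= -!rnormE ler_normD. Qed.

Lemma rnormN V (x : V) : rnorm (- x) = rnorm x.
Proof. by rewrite /rnorm normrN. Qed.

Lemma rnormB V (x y : V) : rnorm (x - y) <= rnorm x + rnorm y.
Proof. by rewrite (le_trans (rnormD _ _))// rnormN. Qed.

Lemma rdistC V (x y : V) : rnorm (x - y) = rnorm (y - x).
Proof. by rewrite -rnormN opprB. Qed.

Lemma rdist_triangle V (y x z : V) :
  rnorm (x - z) <= rnorm (x - y) + rnorm (y - z).
Proof. by rewrite -[x - z](subrKA y) rnormD. Qed.

Lemma rnormZ V (c : R[i]) (x : V) : rnorm (c *: x) = complex.Re `|c| * rnorm x.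
Proof.
suff : (rnorm (c *: x))%:C = (complex.Re `|c| * rnorm x)%:C by case.
by rewrite rmorphM /= -!rnormE normrZ.
Qed.

Lemma rnormZr V (c : R) (x : V) : 0 <= c -> rnorm (c%:C *: x) = c * rnorm x.
Proof. by move=> c0; rewrite rnormZ ger0_norm ?ler0c. Qed.

Lemma rnorm_small V (x : V) : (forall e : R, 0 < e -> rnorm x <= e) -> x = 0.
Proof.
move=> xe; apply: rnorm_eq0; apply/eqP; rewrite eq_le rnorm_ge0 andbT.
by apply/ler_addgt0Pr => e e0; rewrite add0r; exact: xe.
Qed.

Lemma closure_rnorm V (S : set V) x :
  closure S x <-> forall e : R, 0 < e -> exists2 y, S y & rnorm (x - y) < e.
Proof.
split=> [Sx e e0|h B /nbhs_ballP[e /= e0 eB]].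
  have e0' : 0 < e%:C by rewrite ltcR.
  have [y [Sy]] := Sx _ (nbhsx_ballx x _ e0').
  by rewrite -ball_normE /= rnormE ltcR; exists y.
have eE : e = (complex.Re e)%:C by rewrite RRe_real // gtr0_real.
have [|y Sy xy] := h (complex.Re e); first by rewrite -ltcR -eE.
by exists y; split => //; apply: eB; rewrite -ball_normE /= eE rnormE ltcR.
Qed.

Lemma closedP V (S : set V) : closed S <->
  forall x, (forall e : R, 0 < e -> exists2 y, S y & rnorm (x - y) < e) -> S x.
Proof.
split=> [cS x /closure_rnorm|h x /closure_rnorm]; [exact: cS | exact: h].
Qed.

(** Equations between Lipschitz maps survive limits. Together with the closed-set clause of
    [iter_fixpoint] this carries self-adjointness and commutation over to square roots and
    inverses. *)
Lemma closed_lipschitz_eq V (W : completeNormedModType R[i]) (f g : V -> W) (M : R) :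
  (forall x y, rnorm (f x - f y) <= M * rnorm (x - y)) ->
  (forall x y, rnorm (g x - g y) <= M * rnorm (x - y)) ->
  closed [set x | f x = g x].
Proof.
move=> hf hg; apply/closedP => x hx /=; apply/eqP; rewrite -subr_eq0; apply/eqP.
apply: rnorm_small => e e0.
have M0 : 0 < 2 * (`|M| + 1) by rewrite mulr_gt0// ltr_wpDl.
have [y /= fy xy] := hx _ (divr_gt0 e0 M0).
apply: le_trans (rdist_triangle (f y) _ _) _; rewrite [in X in _ + X]fy.
have [f1 g1] := (hf x y, hg y x); rewrite [in X in _ <= X]rdistC in g1.
have MM := ler_norm M; have := rnorm_ge0 (x - y).
move: xy; rewrite ltr_pdivlMr// => xy n0.
nra.
Qed.

(** The increments of [t] telescope, so [u m] stays within [sup (range t) - t k] of [u k] for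
    [m >= k]; a bound on [t] is enough and no rate is required. *)
Lemma majorant_cvg V (u : nat -> V) (t : nat -> R) (M : R) :
  (forall n, rnorm (u n.+1 - u n) <= t n.+1 - t n) -> (forall n, t n <= M) ->
  exists l, forall e, 0 < e -> exists n0, forall n, (n0 <= n)%N -> rnorm (u n - l) < e.
Proof.
move=> ut tM.
have um n m : rnorm (u (n + m)%N - u n) <= t (n + m)%N - t n.
  elim: m => [|m IH]; first by rewrite addn0 !subrr rnorm0.
  rewrite addnS; have := rdist_triangle (u (n + m)%N) (u (n + m).+1) (u n).
  by have := ut (n + m)%N; lra.
have E : has_sup (range t).
  split; first by exists (t 0%N), 0%N.
  by exists M => _ [n _ <-].
have Cu : cauchy (u @ \oo).
  apply/cauchyP => e e0; have eE : e = (complex.Re e)%:C by rewrite RRe_real // gtr0_real.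
  have e0' : 0 < complex.Re e by rewrite -ltcR -eE.
  have [_ [k _ <-] tk] := sup_adherent e0' E.
  exists (u k); exists k => // m /= km.
  rewrite -ball_normE /= distrC rnormE eE ltcR -(subnKC km).
  apply: le_lt_trans (um _ _) _.
  have : t (k + (m - k))%N <= sup (range t) by apply: ub_le_sup; [case: E | exists (k + (m - k))%N].
  by lra.
have /cvg_ex[l ul] : cvg (u @ \oo) by exact: cauchy_cvg.
exists l => e e0; have e0' : 0 < e%:C by rewrite ltcR.
have [n0 _ h] := (proj1 (cvgrPdist_lt _ _) ul) _ e0'.
by exists n0 => n /h /=; rewrite rnormE ltcR rdistC.
Qed.

Lemma iter_fixpoint V (F : V -> V) (t : nat -> R) (M : R) :
  (forall x y, rnorm (F x - F y) <= (1 + rnorm x + rnorm y) * rnorm (x - y)) ->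
  (forall n, rnorm (iter n.+1 F 0 - iter n F 0) <= t n.+1 - t n) ->
  (forall n, t n <= M) ->
  exists2 l, F l = l &
    forall S : set V, closed S -> S 0 -> (forall x, S x -> S (F x)) -> S l.
Proof.
move=> FL /majorant_cvg tM /tM[l ul]; exists l.
  apply/eqP; rewrite -subr_eq0; apply/eqP; apply: rnorm_small => e e0.
  (* As [d <= 1], an iterate within [d] of [l] has norm at most [rnorm l + 1], and the Lipschitz
     factor is at most [2 + 2 * rnorm l]. The further factor 2 leaves room for the distance from the
     next iterate to [l]. *)
  pose d := Num.min 1 (e / (2 * (2 + 2 * rnorm l))).
  have l0 := rnorm_ge0 l.
  have k0 : 0 < 2 * (2 + 2 * rnorm l) by lra.
  have d0 : 0 < d by rewrite lt_min ltr01 divr_gt0.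
  have d1 : d <= 1 by rewrite ge_min lexx.
  have d2 : d * (2 * (2 + 2 * rnorm l)) <= e.
    by rewrite -ler_pdivlMr// ge_min lexx orbT.
  have [n un] := ul d d0.
  have [h1 h2] := (un n (leqnn _), un n.+1 (leqnSn _)).
  have := rdist_triangle (F (iter n F 0)) (F l) l.
  rewrite -iterS [rnorm (F l - iter _ _ _)]rdistC; have := FL (iter n F 0) l; rewrite -iterS.
  have : rnorm (iter n F 0) <= rnorm (iter n F 0 - l) + rnorm l.
    by rewrite -[X in rnorm X <= _](subrK l) rnormD.
  have := (rnorm_ge0 (iter n F 0 - l), rnorm_ge0 (iter n F 0)) => -[].
  move: (rnorm (iter n F 0 - l)) (rnorm (iter n F 0)) (rnorm (iter n.+1 F 0 - l)) h1 h2.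
  move=> a b c ad cd a0 b0 ba h3 h4.
  have : (1 + b + rnorm l) * a <= (2 + 2 * rnorm l) * d by apply: ler_pM; lra.
  have : 0 <= rnorm l * d by rewrite mulr_ge0 // ltW.
  lra.
move=> S cS S0 SF; apply/(proj1 (closedP S) cS) => e e0.
have [n un] := ul e e0; exists (iter n F 0); last by rewrite rdistC un.
by elim: n {un} => //= n; exact: SF.
Qed.

End real_norm.

Local Notation "a · b" := (@amul _ _ a b) (at level 40, left associativity).
Local Notation "a †" := (@astar _ _ a) (at level 2, format "a †").

(** * Arithmetic, square roots and contractive homomorphisms in C*-algebras without a unit *)

Section star_algebra_theory.
Local Open Scope complex_scope.
Variable R : realType.

Lemma scaler2r (V : lmodType R[i]) (x : V) : 2%:R%:C *: x = x + x.
Proof. by rewrite rmorph_nat scaler_nat mulr2n. Qed.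

Section generic.
Variable A : cstar_algebra R.
Implicit Types (a b x y h k : A) (c : R[i]).

Lemma amulDl x x' y : (x + x') · y = x · y + x' · y.
Proof. by have := amul_linearl 1 x x' y; rewrite !scale1r. Qed.
Lemma amulDr x y y' : x · (y + y') = x · y + x · y'.
Proof. by have := amul_linearr 1 x y y'; rewrite !scale1r. Qed.
Lemma amul0l y : (0 : A) · y = 0.
Proof. by apply: (addrI (0 · y)); rewrite -amulDl !addr0. Qed.
Lemma amul0r y : y · (0 : A) = 0.
Proof. by apply: (addrI (y · 0)); rewrite -amulDr !addr0. Qed.
Lemma amulZl c x y : (c *: x) · y = c *: (x · y).
Proof. by have := amul_linearl c x 0 y; rewrite amul0l !addr0. Qed.
Lemma amulZr c x y : x · (c *: y) = c *: (x · y).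
Proof. by have := amul_linearr c x y 0; rewrite amul0r !addr0. Qed.
Lemma amulNl x y : (- x) · y = - (x · y).
Proof. by rewrite -scaleN1r amulZl scaleN1r. Qed.
Lemma amulNr x y : x · (- y) = - (x · y).
Proof. by rewrite -scaleN1r amulZr scaleN1r. Qed.
Lemma amulBl x x' y : (x - x') · y = x · y - x' · y.
Proof. by rewrite amulDl amulNl. Qed.
Lemma amulBr x y y' : x · (y - y') = x · y - x · y'.
Proof. by rewrite amulDr amulNr. Qed.

Lemma astarD x y : (x + y)† = x† + y†.
Proof. by have := astar_antilinear 1 x y; rewrite rmorph1 !scale1r. Qed.
Lemma astar0 : (0 : A)† = 0.
Proof. by apply: (addrI (0 †)); rewrite -astarD !addr0. Qed.
Lemma astarZ c x : (c *: x)† = c^*%C *: x†.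
Proof. by have := astar_antilinear c x 0; rewrite astar0 !addr0. Qed.
Lemma astarZr (c : R) x : (c%:C *: x)† = c%:C *: x†.
Proof. by rewrite astarZ conjc_real. Qed.
Lemma astarN x : (- x)† = - x†.
Proof. by rewrite -scaleN1r astarZ rmorphN1 scaleN1r. Qed.
Lemma astarB x y : (x - y)† = x† - y†.
Proof. by rewrite astarD astarN. Qed.

Lemma amul_commute a x y : a · x = x · a -> a · y = y · a -> a · (x · y) = x · y · a.
Proof. by move=> cx cy; rewrite amulA cx -amulA cy amulA. Qed.

Lemma rnormM x y : rnorm (x · y) <= rnorm x * rnorm y.
Proof. by rewrite -lecR rmorphM /= -!rnormE amul_norm. Qed.

Lemma rnorm_cstar x : rnorm (x† · x) = rnorm x ^+ 2.
Proof.
suff : (rnorm (x† · x))%:C = (rnorm x ^+ 2)%:C by case.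
by rewrite rmorphXn /= -!rnormE acstar_identity.
Qed.

Lemma rnorm_star x : rnorm x† = rnorm x.
Proof.
suff h y : rnorm y <= rnorm y†.
  by apply/eqP; rewrite eq_le h andbT -{2}[x]astarK h.
have := rnormM y† y; rewrite rnorm_cstar.
have [->|y0] := eqVneq (rnorm y) 0; first by rewrite rnorm_ge0.
by rewrite expr2 ler_pM2r// lt0r y0 rnorm_ge0.
Qed.

Lemma rnorm_sqr x : x† = x -> rnorm (x · x) = rnorm x ^+ 2.
Proof. by move=> sx; rewrite -rnorm_cstar sx. Qed.

Lemma amul_star_eq0 x : x · x† = 0 -> x = 0.
Proof.
move=> xx; rewrite -[x]astarK; suff -> : x† = 0 by rewrite astar0.
apply: rnorm_eq0; apply/eqP; rewrite -sqrf_eq0 -rnorm_cstar astarK xx.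
by rewrite rnorm0.
Qed.

(* [c + ir] is normal with square modulus [c^2 + r^2] *)
Lemma rnorm_two_squares (c r : A) : c† = c -> r† = r -> c · r = r · c ->
  rnorm c ^+ 2 <= rnorm (c · c + r · r).
Proof.
move=> sc sr cr; pose u := c + 'i%C *: r.
have su : u† = c - 'i%C *: r.
  have -> : - ('i%C *: r) = (- 'i%C) *: r by rewrite scaleNr.
  rewrite astarD astarZ sc sr; congr (_ + _ *: _).
  by apply/eqP; rewrite eq_complex /= oppr0 !eqxx.
have uu : u† · u = c · c + r · r.
  rewrite su amulBl !amulDr !amulZl !amulZr cr scalerA -expr2 sqr_i scaleN1r.
  by rewrite opprD opprK addrA addrK.
have cE : 2%:R%:C *: c = u† + u.
  by rewrite su /u addrACA addNr addr0 scaler2r.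
have u0 := rnorm_ge0 u.
have : rnorm c <= rnorm u.
  have := rnormD u† u; rewrite -cE rnorm_star rnormZr ?ler0n// => h; lra.
by move=> cu; rewrite -uu rnorm_cstar lerXn2r ?nnegrE ?rnorm_ge0.
Qed.

Lemma rnorm_two_squares_eq0 (c r : A) : c† = c -> r† = r -> c · r = r · c ->
  c · c + r · r = 0 -> c = 0.
Proof.
move=> sc sr cr cr0; have := rnorm_two_squares sc sr cr.
rewrite cr0 rnorm0 => c0; apply: rnorm_eq0; apply/eqP.
by rewrite -sqrf_eq0 eq_le c0 sqr_ge0.
Qed.

Lemma closed_selfadjoint : closed [set x : A | x† = x].
Proof.
apply: (closed_lipschitz_eq (M := 1)) => x y; rewrite mul1r//.
by rewrite -astarB rnorm_star.
Qed.

Lemma closed_commutant a : closed [set x : A | a · x = x · a].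
Proof.
apply: (closed_lipschitz_eq (M := rnorm a)) => x y.
  by rewrite -amulBr rnormM.
by rewrite -amulBl mulrC rnormM.
Qed.

Lemma closed_left_fixed a : closed [set x : A | a · x = x].
Proof.
apply: (closed_lipschitz_eq (M := 1 + rnorm a)) => x y; rewrite mulrDl mul1r.
  by rewrite -amulBr (le_trans (rnormM _ _))// lerDr rnorm_ge0.
by rewrite lerDl mulr_ge0 ?rnorm_ge0.
Qed.

(** A fixed point satisfies [2 k = h + k^2], which is [(1 - k)^2 = 1 - h] written without a unit. *)
Definition sqrt_step h k := 2^-1%:C *: (h + k · k).

(* [1 - k] is the square root of [1 - h] *)
Lemma sqrt_one_minus h : rnorm h <= 1 ->
  exists k, [/\ 2%:R%:C *: k = h + k · k, rnorm k <= 1 &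
    forall S : set A, closed S -> S 0 -> (forall x, S x -> S (sqrt_step h x)) -> S k].
Proof.
(* [t] is the scalar iteration for [h = 1]; it increases, stays below 1 and majorizes the iteration
   of [sqrt_step h]. *)
move=> h1; pose t n := iter n (fun s : R => 2^-1 * (1 + s ^+ 2)) 0.
have t01 n : 0 <= t n <= 1.
  elim: n => [|n /= IH]; first by rewrite /t /= lexx ler01.
  by rewrite -/(t n); move: (t n) IH => s; nra.
have u1 n : rnorm (iter n (sqrt_step h) 0) <= t n.
  elim: n => [|n IH]; first by rewrite /= rnorm0.
  rewrite /= rnormZr; last by lra.
  rewrite -/(t n) ler_wpM2l; [by []|lra|].
  rewrite (le_trans (rnormD _ _))// lerD// (le_trans (rnormM _ _))//.
  by rewrite expr2 ler_pM ?rnorm_ge0.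
have FB x y : rnorm (sqrt_step h x - sqrt_step h y) <=
    2^-1 * ((rnorm x + rnorm y) * rnorm (x - y)).
  rewrite -scalerBr rnormZr; last by lra.
  rewrite opprD addrACA subrr add0r ler_wpM2l; [by []|lra|].
  have -> : x · x - y · y = x · (x - y) + (x - y) · y.
    by rewrite amulBr amulBl subrKA.
  rewrite (le_trans (rnormD _ _))// mulrDl lerD ?rnormM//.
  by rewrite mulrC rnormM.
have [|n|n|k kF kS] := @iter_fixpoint R A (sqrt_step h) t 1.
- move=> x y; apply: le_trans (FB x y) _.
  have := rnorm_ge0 (x - y); have := rnorm_ge0 x; have := rnorm_ge0 y.
  by move: (rnorm x) (rnorm y) (rnorm (x - y)) => a b d; nra.
- elim: n => [|n IH]; first by have := u1 1%N; rewrite subr0 /t /= subr0.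
  have := FB (iter n.+1 (sqrt_step h) 0) (iter n (sqrt_step h) 0).
  rewrite -!iterS => /le_trans; apply.
  have := u1 n; have := u1 n.+1; have := t01 n; have := t01 n.+1.
  have -> : t n.+2 - t n.+1 = 2^-1 * ((t n.+1 + t n) * (t n.+1 - t n)).
    by rewrite /t /= -/(t n); field.
  move=> ? ? h2 h3; rewrite ler_wpM2l//; first lra.
  by rewrite ler_pM ?rnorm_ge0 ?addr_ge0 ?rnorm_ge0// lerD.
- by case/andP: (t01 n).
exists k; split => //.
- rewrite -[in LHS]kF /sqrt_step scalerA -rmorphM /= divff ?scale1r//.
  by rewrite pnatr_eq0.
- apply: (kS [set x | rnorm x <= 1]).
  + apply/closedP => x hx /=; apply/ler_addgt0Pr => e e0.
    have [y /= y1 xy] := hx e e0.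
    by have := rnormD (x - y) y; rewrite subrK; lra.
  + by rewrite /= rnorm0 ler01.
  + move=> x /= x1; rewrite rnormZr; last lra.
    have := rnormD h (x · x); have := rnormM x x; have := rnorm_ge0 x.
    by nra.
Qed.

Lemma sqrt_step_commute h a k : a · h = h · a -> a · k = k · a ->
  a · sqrt_step h k = sqrt_step h k · a.
Proof.
by move=> ah ak; rewrite amulZr amulZl amulDr amulDl ah amulA ak -!amulA ak.
Qed.

Lemma sqrt_step_star h k : h† = h -> k† = k -> (sqrt_step h k)† = sqrt_step h k.
Proof. by move=> sh sk; rewrite astarZr astarD astar_mul sh sk. Qed.

End generic.

(* With [X = f x] and [K] the image of [1 - sqrt(1 - x^2)] one has [X^2 + (1 - K)^2 = 1];
   multiplying by [X^2] turns this into an identity that makes sense without a unit. *)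
Lemma star_hom_contractive (A B : cstar_algebra R) (D : set A) (f : A -> B) :
  is_cstar_subalgebra D ->
  (forall c x y, D x -> D y -> f (c *: x + y) = c *: f x + f y) ->
  (forall x y, D x -> D y -> f (x · y) = f x · f y) ->
  (forall x, D x -> f x† = (f x)†) ->
  forall x, D x -> rnorm (f x) <= rnorm x.
Proof.
move=> [[D0 DD] cD DM DS] fL fM fS.
have DZ c x : D x -> D (c *: x) by move=> Dx; rewrite -[_ *: _]addr0; exact: DD.
have DA x y : D x -> D y -> D (x + y) by move=> Dx Dy; rewrite -[x]scale1r; exact: DD.
have fA x y : D x -> D y -> f (x + y) = f x + f y.
  by move=> Dx Dy; have := fL 1 x y Dx Dy; rewrite !scale1r.
have f0 : f 0 = 0 by apply: (addrI (f 0)); rewrite -fA// !addr0.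
have fZ c x : D x -> f (c *: x) = c *: f x.
  by move=> Dx; have := fL c x 0 Dx D0; rewrite f0 !addr0.
(* Dividing by [rnorm x + e], which is positive even for [x = 0], reduces to the unit ball; passing
   to [x† · x] reduces to self-adjoint elements. *)
suff H x : D x -> x† = x -> rnorm x <= 1 -> rnorm (f x) <= 1.
  have H' x : D x -> x† = x -> rnorm (f x) <= rnorm x.
    move=> Dx sx; apply/ler_addgt0Pr => e e0.
    have n0 : 0 < rnorm x + e by rewrite ltr_wpDl ?rnorm_ge0.
    have := H (((rnorm x + e)^-1)%:C *: x) (DZ _ _ Dx).
    rewrite astarZr sx fZ// !rnormZr ?invr_ge0 ?(ltW n0)//.
    rewrite ![_^-1 * _]mulrC !ler_pdivrMr// !mul1r => -> //; lra.
  move=> x Dx; have := H' (x† · x) (DM _ _ (DS _ Dx) Dx).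
  rewrite astar_mul astarK fM ?fS//; last exact: DS.
  rewrite !rnorm_cstar => /(_ erefl).
  by rewrite ler_pXn2r ?nnegrE ?rnorm_ge0.
move=> Dx sx x1.
have [|k [kE _ kS]] := @sqrt_one_minus A (x · x).
  by rewrite (le_trans (rnormM _ _))// mulr_ile1 ?rnorm_ge0.
(* [f] is controlled on [D] only, so the equations for [k] can be mapped by [f] once [k] is known to
   stay in [D]. *)
have Dk : D k.
  by apply: kS => // y Dy; apply/DZ/DA; exact: DM.
have sk : k† = k.
  apply: (kS [set y | y† = y]); [exact: closed_selfadjoint|exact: astar0|].
  by move=> y /= sy; rewrite sqrt_step_star// astar_mul sx.
have xk : x · k = k · x.
  apply: (kS [set y | x · y = y · x]); first exact: closed_commutant.
    by rewrite /= amul0r amul0l.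
  by move=> y /= xy; apply: sqrt_step_commute; rewrite // amulA.
have := erefl (f (2%:R%:C *: k)); rewrite {2}kE fZ// fA ?fM//; try exact: DM.
have /(congr1 f) := xk; rewrite !fM//.
have := fS _ Dk; have := fS _ Dx; rewrite sk sx.
move: (f x) (f k) => X K' sX sK XK KE.
have {}sX : X† = X by []. have {}sK : K'† = K' by [].
have XXK : X · X · K' = K' · (X · X) by rewrite -amulA XK !amulA XK.
(* [r] stands for [(1 - K') X], so that [X^4 + r^2 = X^2]; the two-squares bound then reads
   [s^2 <= s] for [s = rnorm (X · X)]. *)
pose r := X - K' · X.
have sr : r† = r by rewrite astarB astar_mul sX sK XK.
have Xr : X · r = r · X by rewrite amulBr amulBl amulA XK.
have cr : X · X · r = r · (X · X) by rewrite -amulA Xr !amulA Xr.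
have sXX : (X · X)† = X · X by rewrite astar_mul sX.
have /= := rnorm_two_squares sXX sr cr.
have -> : X · X · (X · X) + r · r = X · X.
  have XXE : X · X = 2%:R%:C *: K' - K' · K' by rewrite KE addrK.
  rewrite {1}XXE /r amulBl !amulBr amulBl amulZl.
  have -> : X · (K' · X) = K' · (X · X) by rewrite amulA XK amulA.
  have -> : K' · X · (K' · X) = K' · K' · (X · X).
    by rewrite -amulA (amulA X) XK !amulA.
  have -> : K' · X · X = K' · (X · X) by rewrite amulA.
  rewrite scaler2r.
  move: (K' · (X · X)) (K' · K' · _) => P Q.
  by rewrite -[_ - P - _]addrA -opprD [P + (P - Q)]addrA addrCA subrr addr0.
move=> h; have : rnorm (X · X) <= 1.
  by have := rnorm_ge0 (X · X); move: (rnorm _) h => s; nra.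
by rewrite rnorm_sqr// expr_le1 ?rnorm_ge0.
Qed.

End star_algebra_theory.

(** * Inverses, approximate units and square roots in unital C*-algebras *)

Section unital_theory.
Local Open Scope complex_scope.
Variable R : realType.

Definition is_unit_element (A : cstar_algebra R) (e : A) :=
  forall a : A, e · a = a /\ a · e = a.

Section unital.
Variables (A : cstar_algebra R) (e : A).
Hypothesis he : is_unit_element e.
Implicit Types (a b x y z g h p v : A).

Let e1 a : e · a = a. Proof. by case: (he a). Qed.
Let e2 a : a · e = a. Proof. by case: (he a). Qed.

Lemma astar_unit : e† = e.
Proof. by rewrite -[LHS]e2 -[RHS]astarK -[e† in RHS]e2 astar_mul astarK. Qed.

(** Only an inequality, since [e = 0] in the zero algebra. *)
Lemma rnorm_unit : rnorm e <= 1.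
Proof.
have := rnorm_cstar e; rewrite astar_unit e1.
by have := rnorm_ge0 e; move: (rnorm e) => s; nra.
Qed.

(** With [e - k] the square root of [e - x^2], the unit [e = (e - k)^2 + x^2] is a sum of two
    commuting self-adjoint squares, whence [rnorm (e - k) ^+ 2 <= rnorm e]. *)
Lemma rnorm_unit_sub_sqr x : x† = x -> rnorm x <= 1 -> rnorm (e - x · x) <= 1.
Proof.
move=> sx x1; have [|k [kE _ kS]] := @sqrt_one_minus R A (x · x).
  by rewrite (le_trans (rnormM _ _))// mulr_ile1 ?rnorm_ge0.
have sk : k† = k.
  apply: (kS [set y | y† = y]); [exact: closed_selfadjoint|exact: astar0|].
  by move=> y /= sy; rewrite sqrt_step_star// astar_mul sx.
have xk : x · k = k · x.
  apply: (kS [set y | x · y = y · x]); first exact: closed_commutant.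
    by rewrite /= amul0r amul0l.
  by move=> y /= xy; apply: sqrt_step_commute; rewrite // amulA.
have sE : e - x · x = (e - k) · (e - k).
  rewrite amulBl !amulBr !e1 !e2 opprB -addrA; congr (_ + _).
  have -> : x · x = k + k - k · k by rewrite -scaler2r kE addrK.
  by rewrite opprB opprD [RHS]addrCA.
have sek : (e - k)† = e - k by rewrite astarB astar_unit sk.
rewrite sE rnorm_sqr//; apply: (@le_trans _ _ (rnorm e)); last exact: rnorm_unit.
have {2}-> : e = (e - k) · (e - k) + x · x by rewrite -sE subrK.
by apply: rnorm_two_squares; rewrite // amulBl amulBr e1 e2 xk.
Qed.

(** The inverse is the fixed point of [b -> e + h b], with the partial sums of the geometric series
    as majorant. It commutes with [h] as all iterates do, so it is two-sided. *)
Lemma neumann h (s : R) : rnorm h <= s -> s < 1 ->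
  exists p, p · (e - h) = e /\ (e - h) · p = e.
Proof.
move=> hs s1; have s0 : 0 <= s by exact: le_trans (rnorm_ge0 h) hs.
have s1' : 0 < 1 - s by lra.
pose F b := e + h · b.
have FB x y : rnorm (F x - F y) <= s * rnorm (x - y).
  rewrite /F opprD addrACA subrr add0r -amulBr (le_trans (rnormM _ _))//.
  by rewrite ler_wpM2r ?rnorm_ge0.
have [|n|n|p pF pS] := @iter_fixpoint R A F (fun n => (1 - s ^+ n) / (1 - s)) (1 - s)^-1.
- move=> x y; apply: le_trans (FB x y) _; rewrite ler_wpM2r ?rnorm_ge0//.
  by have := rnorm_ge0 x; have := rnorm_ge0 y; lra.
- have -> : (1 - s ^+ n.+1) / (1 - s) - (1 - s ^+ n) / (1 - s) = s ^+ n.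
    by rewrite exprS; field; rewrite gt_eqF.
  elim: n => [|n IH]; first by rewrite /= /F amul0r addr0 subr0 rnorm_unit.
  by rewrite exprS; apply: le_trans (FB _ _) _; rewrite ler_wpM2l.
- rewrite ler_pdivrMr// mulVf ?gt_eqF//.
  by rewrite lerBlDr lerDl exprn_ge0.
have hp : h · p = p · h.
  apply: (pS [set y | h · y = y · h]); first exact: closed_commutant.
    by rewrite /= amul0r amul0l.
  by move=> y /= hy; rewrite /F amulDr amulDl e1 e2 hy amulA hy.
exists p; rewrite amulBl amulBr e1 e2 -hp -[X in X - _]pF /F addrK.
by [].
Qed.

(** With [y = x / M] in the unit ball, [e + x^2 = (1 + M^2) (e - s (e - y^2))] for
    [s = M^2 / (1 + M^2) < 1], and [e - y^2] is a contraction, so the Neumann series applies. *)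
Lemma inverse_one_plus_sqr x : x† = x ->
  exists p, [/\ p† = p, p · (e + x · x) = e, (e + x · x) · p = e & x · p = p · x].
Proof.
move=> sx; pose M := rnorm x + 1; have x0 := rnorm_ge0 x.
have M0 : 0 < M by rewrite /M; lra.
have M20 : 0 < 1 + M ^+ 2 by have := sqr_ge0 M; lra.
pose y := M^-1%:C *: x.
have y1 : rnorm (e - y · y) <= 1.
  apply: rnorm_unit_sub_sqr; first by rewrite astarZr sx.
  rewrite rnormZr ?invr_ge0 ?(ltW M0)// ler_pdivrMl// mulr1 /M; lra.
have [||q [q1 q2]] := @neumann ((M ^+ 2 / (1 + M ^+ 2))%:C *: (e - y · y)) (M ^+ 2 / (1 + M ^+ 2)).
- rewrite rnormZr; last by rewrite divr_ge0 ?sqr_ge0// ltW.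
  by rewrite ler_piMr// divr_ge0 ?sqr_ge0// ltW.
- by rewrite ltr_pdivrMr// mul1r; lra.
have eE : e + x · x = (1 + M ^+ 2)%:C *:
    (e - (M ^+ 2 / (1 + M ^+ 2))%:C *: (e - y · y)).
  rewrite /y amulZl amulZr !scalerA !scalerBr !scalerA -!rmorphM /=.
  rewrite opprB addrCA addrC -scalerBl -rmorphB /=.
  congr (_ + _).
    by rewrite -[LHS]scale1r; congr (_ *: _); congr (_%:C); field; rewrite gt_eqF.
  rewrite -[LHS]scale1r; congr (_ *: _); congr (_%:C); field.
  by rewrite !gt_eqF.
pose p := (1 + M ^+ 2)^-1%:C *: q.
have VC : ((1 + M ^+ 2)%:C * (1 + M ^+ 2)^-1%:C : R[i]) = 1.
  by rewrite -rmorphM /= divff// gt_eqF.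
have p1 : p · (e + x · x) = e.
  by rewrite eE amulZl amulZr scalerA mulrC VC scale1r q1.
have p2 : (e + x · x) · p = e.
  by rewrite eE amulZl amulZr scalerA VC scale1r q2.
have sp : p† = p.
  rewrite -[LHS]e2 -p2 amulA; have -> : p† · (e + x · x) = e; last exact: e1.
  have {1}<- : (e + x · x)† = e + x · x by rewrite astarD astar_mul sx astar_unit.
  by rewrite -astar_mul p2 astar_unit.
exists p; split => //.
rewrite -[x · p]e1 -p1 -!amulA; congr (_ · _).
have -> : (e + x · x) · (x · p) = x · ((e + x · x) · p).
  by rewrite !amulA amulDl amulDr e1 e2 amulA.
by rewrite p2 e2.
Qed.

(** For [y = x / (2 eps)] and [p = (1 + y^2)^-1] one has [(p - 1/2)^2 + (y p)^2 = 1/4]. The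
    two-squares bound gives at once that [p - 1/2] and [y p] have norm at most 1/2, which are the
    two estimates; moreover [e - p = y^2 p]. *)
Lemma approximate_unit x (eps : R) : x† = x -> 0 < eps ->
  exists p q, [/\ p† = p, rnorm p <= 1, e - p = x · q & rnorm (x · p) <= eps].
Proof.
move=> sx e0; have e20 : 0 < (2 * eps)^-1 by rewrite invr_gt0; lra.
pose l := (2 * eps)^-1; pose y := l%:C *: x.
have sy : y† = y by rewrite astarZr sx.
have [p [sp p1 p2 yp]] := inverse_one_plus_sqr sy.
pose c := p - 2^-1%:C *: e; pose r := y · p.
have sc : c† = c by rewrite astarB astarZr sp astar_unit.
have sr : r† = r by rewrite astar_mul sp sy -yp.
have pr : p · r = r · p by rewrite /r amulA -yp.
have cr : c · r = r · c by rewrite amulBl amulBr amulZl amulZr e1 e2 pr.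
have E : c · c + r · r = 4^-1%:C *: e.
  have rr : r · r = p - p · p.
    rewrite /r {1}yp -{3}[p]e2 -p2 amulDl e1 amulDr addrAC subrr add0r.
    by rewrite !amulA.
  have pE : p = 2^-1%:C *: p + 2^-1%:C *: p.
    by rewrite -scaler2r scalerA -rmorphM /= divff ?scale1r// pnatr_eq0.
  have e4 : 2^-1%:C *: (2^-1%:C *: e) = 4^-1%:C *: e.
    by rewrite scalerA -rmorphM /=; congr (_%:C *: _); field.
  rewrite rr amulBl !amulBr !amulZl !amulZr e1 e2 ?e1 e4.
  move: (p · p) (2^-1%:C *: p) (4^-1%:C *: e) pE => P W Z ->.
  by rewrite opprB [P - W + _]addrACA -opprD subrKA addrAC subrr add0r.
have n4 : rnorm (c · c + r · r) <= 4^-1.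
  rewrite E rnormZr; last by rewrite invr_ge0.
  by have := rnorm_unit; lra.
exists p, (l%:C *: (y · p)); split => //.
- have := rnorm_two_squares sc sr cr; have := rnormD c (2^-1%:C *: e).
  rewrite subrK rnormZr; last by lra.
  have := rnorm_unit; have := rnorm_ge0 c; move: (rnorm p) (rnorm c) => s t.
  by nra.
- rewrite -[X in X - _]p2 amulDl e1 addrAC subrr add0r -amulA.
  by rewrite amulZr /y [LHS]amulZl.
- have := rnorm_two_squares sr sc (esym cr); rewrite addrC => /le_trans /(_ n4).
  have -> : rnorm r = l * rnorm (x · p).
    by rewrite /r /y amulZl rnormZr ?(ltW e20).
  have l0 : 0 <= l := ltW e20.
  have s0 : 0 <= l * rnorm (x · p) by rewrite mulr_ge0 ?rnorm_ge0.
  move=> h; have : l * rnorm (x · p) <= 2^-1 by move: s0 h => s0 h; nra.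
  by rewrite -(ler_pdivlMl _ _ e20) => /le_trans; apply; rewrite /l invrK; lra.
Qed.

(** The hypothesis on [t^2 - g] expresses positivity of [g] by a norm alone. The conclusion on
    [t - v] says the same of [v], so that the lemma can be applied again to [v]. *)
Lemma sqrt_near (t : R) g : 0 < t -> g† = g -> rnorm ((t ^+ 2)%:C *: e - g) <= t ^+ 2 ->
  exists v, [/\ v† = v, v · v = g, rnorm (t%:C *: e - v) <= t &
    forall a, a · g = g · a -> a · v = v · a].
Proof.
move=> t0 sg gt; have t20 : 0 < t ^+ 2 by rewrite exprn_gt0.
pose h := (t ^+ 2)^-1%:C *: ((t ^+ 2)%:C *: e - g).
have hE : (t ^+ 2)%:C *: h = (t ^+ 2)%:C *: e - g.
  by rewrite scalerA -rmorphM /= divff ?gt_eqF// scale1r.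
have [|k [kE k1 kS]] := @sqrt_one_minus R A h.
  by rewrite rnormZr ?invr_ge0 ?(ltW t20)// ler_pdivrMl// mulr1.
have sh : h† = h by rewrite astarZr astarB astarZr astar_unit sg.
have sk : k† = k.
  apply: (kS [set y | y† = y]); [exact: closed_selfadjoint|exact: astar0|].
  by move=> y /= sy; rewrite sqrt_step_star.
exists (t%:C *: (e - k)); split.
- by rewrite astarZr astarB astar_unit sk.
- have -> : g = (t ^+ 2)%:C *: (e - h) by rewrite scalerBr hE opprB addrC subrK.
  rewrite amulZl amulZr scalerA -rmorphM /= -expr2; congr (_ *: _).
  rewrite amulBl !amulBr !e1 !e2 opprB -addrA; congr (_ + _).
  have -> : h = k + k - k · k by rewrite -scaler2r kE addrK.
  by rewrite opprB opprD [RHS]addrCA.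
- by rewrite scalerBr opprB addrC subrK rnormZr ?(ltW t0)// ler_piMr// ltW.
- move=> a ag; rewrite amulZl amulZr amulBl amulBr e1 e2; congr (_ *: (_ - _)).
  apply: (kS [set y | a · y = y · a]); first exact: closed_commutant.
    by rewrite /= amul0r amul0l.
  move=> y /= ay; apply: sqrt_step_commute => //.
  by rewrite amulZl amulZr amulBl amulBr amulZl amulZr e1 e2 ag.
Qed.

(** Here [v · v] is the absolute value of [z], given as a square to record its positivity.
    [sqrt_near] is applied to [z^2] with [t = c], then to the resulting root with
    [t = Num.sqrt c]. *)
Lemma abs_fourth_root z : z† = z ->
  exists v, [/\ v† = v, v · v · (v · v) = z · z &
    forall a, a · z = z · a -> a · v = v · a].
Proof.
move=> sz; pose c := rnorm z + 1; have z0 := rnorm_ge0 z.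
have c0 : 0 < c by rewrite /c; lra.
have [||v1 [sv1 v1E v1n v1c]] := @sqrt_near c (z · z) c0.
- by rewrite astar_mul sz.
- have -> : z · z = (c ^+ 2)%:C *: ((c^-1%:C *: z) · (c^-1%:C *: z)).
    rewrite amulZl amulZr !scalerA -!rmorphM /= (_ : _ * _ = 1) ?scale1r//.
    by field; rewrite gt_eqF.
  rewrite -scalerBr rnormZr ?exprn_ge0 ?(ltW c0)// ler_piMr ?exprn_ge0 ?(ltW c0)//.
  apply: rnorm_unit_sub_sqr; first by rewrite astarZr sz.
  by rewrite rnormZr ?invr_ge0 ?(ltW c0)// ler_pdivrMl// mulr1 /c; lra.
have [||v [sv vE _ vc]] := @sqrt_near (Num.sqrt c) v1 _ sv1.
- by rewrite sqrtr_gt0.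
- by rewrite sqr_sqrtr// ltW.
exists v; split => //; first by rewrite vE v1E.
by move=> a az; apply/vc/v1c; rewrite amulA az -!amulA az.
Qed.

End unital.

End unital_theory.

(** * Positive elements presented as squares, and positive parts *)

Section positivity_theory.
Local Open Scope complex_scope.
Variable R : realType.

(** For [d = u^2 - v^2] the commuting elements [d u] and [d v] are self-adjoint with squares adding
    up to [d (u^4 - v^4) = 0]. Hence both vanish, and so does [d^2]. *)
Lemma positive_sqrt_unique (A : cstar_algebra R) (u v : A) :
  u† = u -> v† = v -> u · v = v · u ->
  u · u · (u · u) = v · v · (v · v) -> u · u = v · v.
Proof.
suff h (p q : A) : p† = p -> q† = q -> p · q = q · p ->
    p · p · (p · p) = q · q · (q · q) -> (p · p - q · q) · p = 0.
  move=> su sv uv uvE; have d1 := h _ _ su sv uv uvE.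
  have d2 := h _ _ sv su (esym uv) (esym uvE).
  apply/eqP; rewrite -subr_eq0; apply/eqP; apply: amul_star_eq0.
  rewrite astarB !astar_mul su sv amulBr !amulA d1.
  by rewrite -[u · u - v · v]opprB amulNl d2 oppr0 !amul0l subrr.
move=> sp sq pq pqE; set d := _ - _.
have pd : p · d = d · p.
  by rewrite /d amulBr amulBl !amulA pq -(amulA q p q) pq !amulA.
have qd : q · d = d · q.
  by rewrite /d amulBr amulBl !amulA -pq -(amulA p q p) -pq !amulA.
have sd : d† = d by rewrite astarB !astar_mul sp sq.
apply: (@rnorm_two_squares_eq0 _ _ (d · p) (d · q)).
- by rewrite astar_mul sp sd pd.
- by rewrite astar_mul sq sd qd.
- by rewrite -!amulA (amulA p) (amulA q) pd qd -!amulA pq.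
have -> : d · p · (d · p) + d · q · (d · q) = d · (d · (p · p + q · q)).
  by rewrite !amulDr -!amulA (amulA p) (amulA q) pd qd -!amulA.
suff -> : d · (p · p + q · q) = 0 by rewrite amul0r.
rewrite /d amulBl !amulDr pqE.
have -> : p · p · (q · q) = q · q · (p · p).
  by apply: amul_commute; apply/esym/amul_commute.
by rewrite [X in _ - X]addrC subrr.
Qed.

(* [a] is the positive part of [x - eps], [b] its negative part; [b = |b|] and [x >= 0] yield
   [x b^2 = eps b^2 - b^3 >= 0], whence [|b| <= eps] *)
Lemma truncation (A : cstar_algebra R) (e y : A) (eps : R) :
  is_unit_element e -> y† = y -> 0 < eps ->
  exists2 a, rnorm (y · y - a) <= 2%:R * eps &
    forall (B : cstar_algebra R) (f : A -> B), is_star_hom f ->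
      rnorm (f (y · y)) <= eps -> f a = 0.
Proof.
move=> he sy e0; have e1 a : e · a = a by case: (he a).
have e2 a : a · e = a by case: (he a).
have se := astar_unit he.
set x := y · y; pose z := x - eps%:C *: e.
have sx : x† = x by rewrite astar_mul sy.
have sz : z† = z by rewrite astarB sx astarZr se.
have xE : x = z + eps%:C *: e by rewrite subrK.
have [v [sv vE vc]] := abs_fourth_root he sz.
pose w := v · v.
have zE a : a · x = x · a -> a · z = z · a.
  by move=> ax; rewrite /z amulBr amulBl amulZl amulZr e1 e2 ax.
have xv : x · v = v · x by apply/vc/zE.
have yv : y · v = v · y by apply/vc/zE; rewrite amulA.
have zv : z · v = v · z by apply: vc.
have zw : z · w = w · z by rewrite amulA zv -amulA zv amulA.
have sw : w† = w by rewrite astar_mul sv.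
pose a := 2^-1%:C *: (w + z); pose b := 2^-1%:C *: (w - z).
have half (u : A) : 2^-1%:C *: (u + u) = u.
  by rewrite -scaler2r scalerA -rmorphM /= mulVf ?scale1r// pnatr_eq0.
have sb : b† = b by rewrite astarZr astarB sw sz.
have zb : z · b = - (w · b).
  rewrite /b !amulZr -scalerN; congr (_ *: _).
  by rewrite (amulBr z w z) (amulBr w w z) zw -vE -/w opprB.
have bb : b · b = w · b.
  by rewrite {1}/b amulZl amulBl zb opprK half.
have vb : v · b = b · v by rewrite amulZr amulZl amulBr amulBl amulA zv.
have yb : y · b = b · y.
  by rewrite amulZr amulZl amulBr amulBl zE ?amulA// yv -!(amulA v) yv !amulA.
have ybE : y · b · (y · b) = eps%:C *: (b · b) - b · b · b.
  rewrite -amulA (amulA b) -yb -amulA (amulA y) -/x amulA {1}xE.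
  by rewrite amulDl zb amulZl e1 -bb addrC amulBl amulZl.
have vbE : v · b · (v · b) = b · b · b.
  by rewrite -amulA (amulA b) -vb -amulA (amulA v) -/w amulA bb.
have svb : (v · b)† = v · b by rewrite astar_mul sv sb vb.
have syb : (y · b)† = y · b by rewrite astar_mul sy sb yb.
have b0 := rnorm_ge0 b.
(* The squares of [v b] and [y b] add up to [eps b^2], so [b^3 = (v b)^2] has norm at most
   [eps * rnorm b ^+ 2]; compare with [rnorm b ^+ 4 <= rnorm (b^3) * rnorm b]. *)
have be : rnorm b <= eps.
  have vyb : v · b · (y · b) = y · b · (v · b).
    by rewrite -!amulA (amulA b y) (amulA b v) -yb -vb -!amulA (amulA v) (amulA y) yv.
  have := rnorm_two_squares svb syb vyb.
  rewrite vbE ybE addrC subrK rnormZr ?(ltW e0)// rnorm_sqr//.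
  rewrite -(rnorm_sqr svb) vbE => h1.
  have := rnormM (b · b · b) b.
  rewrite -amulA rnorm_sqr; last by rewrite astar_mul sb.
  rewrite rnorm_sqr// => h2.
  have [->|bn0] := eqVneq (rnorm b) 0; first exact: ltW.
  have bp : 0 < rnorm b by rewrite lt0r bn0.
  have h3 : rnorm b ^+ 2 * rnorm b <= eps * rnorm b ^+ 2.
    apply: le_trans h1; rewrite -(ler_pM2r bp); apply: le_trans h2.
    by rewrite -mulrA -!expr2.
  by move: h3; rewrite mulrC ler_pM2r// exprn_gt0.
exists a.
  have -> : x - a = eps%:C *: e - b.
    have zab : z = a - b.
      by rewrite -scalerBr opprB [w + z + _]addrC addrA subrK half.
    by rewrite xE zab addrAC [a - b]addrC addrK addrC.
  have := rnormB (eps%:C *: e) b; rewrite rnormZr ?(ltW e0)//.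
  have := rnorm_unit he; have := rnorm_ge0 e.
  by move: (rnorm e) => s; nra.
move=> B f [fL fM fS] fx.
have fD u u' : f (u + u') = f u + f u' by have := fL 1 u u'; rewrite !scale1r.
have f0 : f 0 = 0 by apply: (addrI (f 0)); rewrite -fD !addr0.
have fZ c u : f (c *: u) = c *: f u by have := fL c u 0; rewrite f0 !addr0.
have fN u : f (- u) = - f u by rewrite -scaleN1r fZ scaleN1r.
have [|k [kE _ kS]] := @sqrt_one_minus R B (eps^-1%:C *: f x).
  by rewrite rnormZr ?invr_ge0 ?(ltW e0)// ler_pdivrMl// mulr1.
have sX : (eps^-1%:C *: f x)† = eps^-1%:C *: f x by rewrite astarZr -fS sx.
have sk : k† = k.
  apply: (kS [set y | y† = y]); [exact: closed_selfadjoint|exact: astar0|].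
  by move=> u /= su; rewrite sqrt_step_star.
have kc c : c · f x = f x · c -> c · k = k · c.
  move=> cx; apply: (kS [set u | c · u = u · c]); first exact: closed_commutant.
    by rewrite /= amul0r amul0l.
  by move=> u /= cu; apply: sqrt_step_commute; rewrite // amulZl amulZr cx.
have qk : f e · k = k.
  apply: (kS [set u | f e · u = u]); first exact: closed_left_fixed.
    by rewrite /= amul0r.
  by move=> u /= eu; rewrite amulZr amulDr amulZr -fM e1 amulA eu.
have kq : k · f e = k by rewrite -[RHS]sk -{2}qk astar_mul sk -fS se.
(* [f e] acts as a unit on [k], so [v2] is a square root of [eps - f x = - f z]. Thus [f w] and
   [- f z] are both squares of self-adjoint elements and have the same square, so they agree and
   [f a = 0]. *)
pose v2 := (Num.sqrt eps)%:C *: (f e - k).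
have v2E : v2 · v2 = - f z.
  rewrite /v2 amulZl amulZr scalerA -rmorphM /= -expr2 sqr_sqrtr ?(ltW e0)//.
  rewrite amulBl !amulBr -fM e1 qk kq fD fN fZ opprB.
  have -> : f e - k + (k · k - k) = f e - eps^-1%:C *: f x.
    have -> : eps^-1%:C *: f x = k + k - k · k by rewrite -scaler2r kE addrK.
    by rewrite opprB -addrA; congr (_ + _); rewrite addrCA opprD.
  by rewrite scalerBr scalerA -rmorphM /= divff ?gt_eqF// scale1r opprB.
have sv2 : v2† = v2 by rewrite astarZr astarB sk -fS se.
have fvv2 : f v · v2 = v2 · f v.
  rewrite amulZr amulZl amulBr amulBl -!fM e1 e2; congr (_ *: (_ - _)).
  by apply: kc; rewrite -!fM xv.
have := positive_sqrt_unique _ sv2 fvv2; rewrite -fS sv => /(_ erefl).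
rewrite v2E amulNl amulNr opprK -!fM vE => /(_ erefl) ww.
by rewrite fZ fD -/w /w ww addNr scaler0.
Qed.

End positivity_theory.

(** * Ideals in C*-categories *)

Section precategory_theory.
Local Open Scope complex_scope.
Variables (R : realType) (T : tensor_data R).
Hypothesis hT : is_cstar_precategory T.

Lemma compDl n m l (a a' : T n m) (b : T m l) : (a + a') ** b = a ** b + a' ** b.
Proof. by have := comp_linearl hT 1 a a' b; rewrite !scale1r. Qed.
Lemma compDr n m l (a : T n m) (b b' : T m l) : a ** (b + b') = a ** b + a ** b'.
Proof. by have := comp_linearr hT 1 a b b'; rewrite !scale1r. Qed.
Lemma comp0l n m l (b : T m l) : (0 : T n m) ** b = 0.
Proof. by apply: (addrI (0 ** b)); rewrite -compDl !addr0. Qed.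
Lemma comp0r n m l (a : T n m) : a ** (0 : T m l) = 0.
Proof. by apply: (addrI (a ** 0)); rewrite -compDr !addr0. Qed.
Lemma compNl n m l (a : T n m) (b : T m l) : (- a) ** b = - (a ** b).
Proof. by apply: (addrI (a ** b)); rewrite -compDl !subrr comp0l. Qed.
Lemma compNr n m l (a : T n m) (b : T m l) : a ** (- b) = - (a ** b).
Proof. by apply: (addrI (a ** b)); rewrite -compDr !subrr comp0r. Qed.
Lemma compBl n m l (a a' : T n m) (b : T m l) : (a - a') ** b = a ** b - a' ** b.
Proof. by rewrite compDl compNl. Qed.
Lemma compBr n m l (a : T n m) (b b' : T m l) : a ** (b - b') = a ** b - a ** b'.
Proof. by rewrite compDr compNr. Qed.
Lemma starD n m (a b : T n m) : star (a + b) = star a + star b.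
Proof. by have := star_antilinear hT 1 a b; rewrite rmorph1 !scale1r. Qed.
Lemma star0 n m : star (0 : T n m) = 0.
Proof. by apply: (addrI (star 0)); rewrite -starD !addr0. Qed.
Lemma starN n m (a : T n m) : star (- a) = - star a.
Proof. by apply: (addrI (star a)); rewrite -starD !subrr star0. Qed.
Lemma starB n m (a b : T n m) : star (a - b) = star a - star b.
Proof. by rewrite starD starN. Qed.

Lemma rnorm_comp n m l (a : T n m) (b : T m l) : rnorm (a ** b) <= rnorm a * rnorm b.
Proof. by rewrite -lecR rmorphM /= -!rnormE comp_norm. Qed.

Lemma rnorm_star_comp n m (a : T n m) : rnorm (star a ** a) = rnorm a ^+ 2.
Proof.
suff : (rnorm (star a ** a))%:C = (rnorm a ^+ 2)%:C by case.
by rewrite rmorphXn /= -!rnormE cstar_identity.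
Qed.

Lemma rnorm_hom_star n m (a : T n m) : rnorm (star a) = rnorm a.
Proof.
suff h i j (b : T i j) : rnorm b <= rnorm (star b).
  by apply/eqP; rewrite eq_le h andbT -{2}[a](starK hT) h.
have := rnorm_comp (star b) b; rewrite rnorm_star_comp.
have [->|b0] := eqVneq (rnorm b) 0; first by rewrite rnorm_ge0.
by rewrite expr2 ler_pM2r// lt0r b0 rnorm_ge0.
Qed.

Lemma comp_star_eq0 n m (a : T n m) : a ** star a = 0 -> a = 0.
Proof.
move=> aa; apply: rnorm_eq0; apply/eqP; rewrite -rnorm_hom_star -sqrf_eq0.
by rewrite -rnorm_star_comp starK// aa rnorm0.
Qed.

(** Morphisms between different objects are brought into this algebra as [star a ** a]. *)
Definition endo_algebra n : cstar_algebra R :=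
  @CstarAlgebra R (T n n) (@Defs.comp R T n n n) (@star R T n n)
    (@comp_linearl R T hT n n n) (@comp_linearr R T hT n n n)
    (fun x y z => @Defs.compA R T hT n n n n x y z) (@comp_norm R T hT n n n)
    (@star_antilinear R T hT n n) (@starK R T hT n n)
    (@star_comp R T hT n n n) (@cstar_identity R T hT n n).

Hypothesis hI : has_identities T.

Section ideals.
Variable K : hom_family T.
Arguments K : clear implicits.
Hypothesis hK : is_ideal K.

Lemma ideal0 n m : K n m 0. Proof. by case: (ideal_subspace hK n m). Qed.
Lemma idealZ n m c (a : T n m) : K n m a -> K n m (c *: a).
Proof.
move=> Ka; have [K0 KD] := ideal_subspace hK n m.
by rewrite -[_ *: _]addr0; exact: KD.
Qed.
Lemma idealD n m (a b : T n m) : K n m a -> K n m b -> K n m (a + b).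
Proof.
by move=> Ka Kb; rewrite -[a]scale1r; have [_] := ideal_subspace hK n m; apply.
Qed.
Lemma idealN n m (a : T n m) : K n m a -> K n m (- a).
Proof. by move=> Ka; rewrite -scaleN1r; exact: idealZ. Qed.
Lemma idealB n m (a b : T n m) : K n m a -> K n m b -> K n m (a - b).
Proof. by move=> Ka Kb; apply: idealD => //; exact: idealN. Qed.

Lemma ideal_limit n m (a : T n m) :
  (forall e : R, 0 < e -> exists2 b, K n m b & rnorm (a - b) < e) -> K n m a.
Proof. exact: (proj1 (closedP _) (@ideal_closed _ _ _ hK n m)). Qed.

(** [approximate_unit] is applied to [star w ** w] with [eps ^+ 2], because [rnorm (w ** p) ^+ 2] is
    the norm of [p ** (star w ** w ** p)]. The unit of [T m m] turns [a - a ** p] into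
    [a ** (1 - p)]. *)
Lemma ideal_approximate_unit n m (w : T n m) (eps : R) :
  K m m (star w ** w) -> 0 < eps ->
  exists p : T m m, [/\ star p = p, rnorm p <= 1,
    (forall l (a : T l m), K l m (a - a ** p)) & rnorm (w ** p) <= eps].
Proof.
move=> Kw e0; have [u [u1 u2]] := hI m.
have sx : star (star w ** w) = star w ** w by rewrite star_comp// starK.
have [p [r [sp p1 pE xp]]] :=
  @approximate_unit R (endo_algebra m) u (fun a => conj (u1 _ a) (u2 _ a))
    (star w ** w) (eps ^+ 2) sx (exprn_gt0 2 e0).
have {}sp : star p = p := sp; have {}p1 : rnorm (p : T m m) <= 1 := p1.
have {}xp : rnorm (star w ** w ** p) <= eps ^+ 2 := xp.
exists p; split => //.
  move=> l a; rewrite -{1}[a]u2 -compBr; apply: ideal_compl => //.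
  by rewrite [X in K m m X]pE; apply: ideal_compr.
rewrite -(@ler_pXn2r _ 2)// ?nnegrE ?rnorm_ge0 ?(ltW e0)// -rnorm_star_comp.
rewrite star_comp// -Defs.compA// [X in _ ** X]Defs.compA// sp.
apply: le_trans (rnorm_comp _ _) _; rewrite -[X in _ <= X]mul1r.
by apply: ler_pM; rewrite ?rnorm_ge0.
Qed.

(** The elements [w - w ** p] lie in [K] and approach [w]. This reduces membership in an ideal to
    positive elements on the diagonal. *)
Lemma ideal_of_star_comp n m (w : T n m) : K m m (star w ** w) -> K n m w.
Proof.
move=> Kw; apply: ideal_limit => e e0.
have e20 : 0 < e / 2 by rewrite divr_gt0.
have [p [_ _ Kp wp]] := ideal_approximate_unit Kw e20.
by exists (w - w ** p); rewrite // subKr; lra.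
Qed.

(** Stability under the involution is derived, not part of [is_ideal]: the product to be tested is
    [w ** star w]. *)
Lemma ideal_star n m (w : T n m) : K n m w -> K m n (star w).
Proof.
by move=> Kw; apply: ideal_of_star_comp; rewrite starK//; exact: ideal_compr.
Qed.

End ideals.

(** * The quotient by an ideal is a C*-category *)

Section quotients.
Variable N : forall n m, closed_subspace (T n m).
Hypothesis hN : is_ideal (fun n m => subspace_set (N n m)).
Local Notation TR := (quotient_data N).
Local Notation q := (quotient_functor N).

Lemma quotient_functorP n m (a b : T n m) : q n m a = q n m b <-> subspace_set (N n m) (a - b).
Proof. by split=> [/eqP/quotient_eqP|/quotient_eqP/eqP]. Qed.

Lemma quotient_functor_eq0 n m (a : T n m) : q n m a = 0 <-> subspace_set (N n m) a.
Proof. by rewrite -{2}[a]subr0; exact: quotient_functorP. Qed.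

Lemma quotient_functor_surj n m (x : TR n m) : exists a, q n m a = x.
Proof. by exists (repr x); exact: reprK. Qed.

Lemma quotient_repr n m (a : T n m) :
  subspace_set (N n m) (repr (q n m a : quotient_space (N n m)) - a).
Proof. by apply/quotient_functorP; exact: reprK. Qed.

Lemma quotient_functorD n m (a b : T n m) : q n m (a + b) = q n m a + q n m b.
Proof. exact: quotient_mapD. Qed.
Lemma quotient_functorZ n m c (a : T n m) : q n m (c *: a) = c *: q n m a.
Proof. exact: quotient_mapZ. Qed.

Lemma quotient_functor_comp n m l (a : T n m) (b : T m l) :
  q n l (a ** b) = q n m a ** q m l b.
Proof.
apply/esym/quotient_functorP; set a' := repr _; set b' := repr _.
have -> : a' ** b' - a ** b = a' ** (b' - b) + (a' - a) ** b.
  by rewrite compBr compBl subrKA.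
apply: (idealD hN); first by apply: (ideal_compl hN); exact: quotient_repr.
by apply: (ideal_compr hN); exact: quotient_repr.
Qed.

Lemma quotient_functor_star n m (a : T n m) : q m n (star a) = star (q n m a).
Proof.
apply/esym/quotient_functorP; rewrite -starB.
by apply: (ideal_star hN); exact: quotient_repr.
Qed.

Lemma rnorm_quotient_functor n m (a : T n m) : rnorm (q n m a) <= rnorm a.
Proof. by rewrite -lecR -!rnormE; exact: quotient_norm_le. Qed.

Lemma quotient_lift n m (x : TR n m) (r : R) : rnorm x < r ->
  exists2 a, q n m a = x & rnorm a < r.
Proof.
rewrite -ltcR -rnormE => /quotient_norm_lt[a ax ar].
by exists a => //; rewrite -ltcR -rnormE.
Qed.

Lemma quotient_lift_le n m (x : TR n m) (r : R) :
  (forall a, q n m a = x -> r <= rnorm a) -> r <= rnorm x.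
Proof.
move=> h; apply/ler_addgt0Pr => e e0.
have [|a ax ar] := @quotient_lift _ _ x (rnorm x + e); first by rewrite ltrDl.
by apply: le_trans (h a ax) _; exact: ltW.
Qed.

(** Let [u] be any lift and [z = u - star a ** a]. An approximate unit [p] for [z] leaves the class
    of [a] unchanged under [a ** p], while [star (a ** p) ** (a ** p) = p ** (u - z) ** p] has norm
    at most [rnorm u + e]. *)
Lemma quotient_rnorm_star_comp n m (a : T n m) :
  rnorm (q n m a) ^+ 2 <= rnorm (q m m (star a ** a)).
Proof.
apply: quotient_lift_le => u /quotient_functorP Nz.
set z := u - _ in Nz; apply/ler_addgt0Pr => e e0.
have [|p [sp p1 Np zp]] := @ideal_approximate_unit _ hN _ _ z e _ e0.
  by apply: (ideal_compl hN).
have -> : q n m a = q n m (a ** p) by apply/quotient_functorP; exact: Np.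
apply: (@le_trans _ _ (rnorm (a ** p) ^+ 2)).
  by rewrite ler_pXn2r ?nnegrE ?rnorm_ge0// rnorm_quotient_functor.
rewrite -rnorm_star_comp star_comp// sp -Defs.compA// [X in _ ** X]Defs.compA//.
have -> : star a ** a = u - z by rewrite subKr.
rewrite compBl; apply: le_trans (rnorm_comp _ _) _.
have := rnormB (u ** p) (z ** p); have := rnorm_comp u p.
have := rnorm_ge0 u; have := rnorm_ge0 p; have := rnorm_ge0 (u ** p - z ** p).
move: (rnorm (u ** p - z ** p)) (rnorm (u ** p)) (rnorm (z ** p)) (rnorm u) (rnorm p) zp p1.
by move=> A B C D E' *; nra.
Qed.

Lemma quotient_precategory : is_cstar_precategory TR.
Proof.
have star_le n m (x : TR n m) : rnorm (star x) <= rnorm x.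
  apply: quotient_lift_le => a <-.
  by rewrite -quotient_functor_star (le_trans (rnorm_quotient_functor _))// rnorm_hom_star.
have comp_le n m l (x : TR n m) (y : TR m l) : rnorm (x ** y) <= rnorm x * rnorm y.
  apply/ler_addgt0Pr => e e0; have x0 := rnorm_ge0 x; have y0 := rnorm_ge0 y.
  (* As [d <= 1], the product [(rnorm x + d) * (rnorm y + d)] exceeds [rnorm x * rnorm y] by at most
     [d * (rnorm x + rnorm y + 1)]. *)
  pose d := Num.min 1 (e / (rnorm x + rnorm y + 1)).
  have d0 : 0 < d by rewrite lt_min ltr01 divr_gt0//; lra.
  have d1 : d <= 1 by rewrite ge_min lexx.
  have d2 : d * (rnorm x + rnorm y + 1) <= e.
    by rewrite -ler_pdivlMr ?ge_min ?lexx ?orbT//; lra.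
  have [|a ax ad] := @quotient_lift _ _ x (rnorm x + d); first by rewrite ltrDl.
  have [|b bx bd] := @quotient_lift _ _ y (rnorm y + d); first by rewrite ltrDl.
  rewrite -[X in rnorm (X ** _)]ax -[X in rnorm (_ ** X)]bx -quotient_functor_comp.
  rewrite (le_trans (rnorm_quotient_functor _))// (le_trans (rnorm_comp _ _))//.
  have : rnorm a * rnorm b <= (rnorm x + d) * (rnorm y + d).
    by rewrite ler_pM ?rnorm_ge0 ?(ltW ad) ?(ltW bd).
  by nra.
have SK n m (x : TR n m) : star (star x) = x.
  by have [a <-] := quotient_functor_surj x; rewrite -!quotient_functor_star starK.
have star_eq n m (x : TR n m) : rnorm (star x) = rnorm x.
  by apply/eqP; rewrite eq_le star_le -{1}[x]SK star_le.
split.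
- move=> n m l c x x' y.
  have [a <-] := quotient_functor_surj x; have [a' <-] := quotient_functor_surj x'.
  have [b <-] := quotient_functor_surj y.
  rewrite -quotient_functorZ -quotient_functorD -!quotient_functor_comp.
  by rewrite -quotient_functorZ -quotient_functorD comp_linearl.
- move=> n m l c x y y'.
  have [a <-] := quotient_functor_surj x; have [b' <-] := quotient_functor_surj y'.
  have [b <-] := quotient_functor_surj y.
  rewrite -quotient_functorZ -quotient_functorD -!quotient_functor_comp.
  by rewrite -quotient_functorZ -quotient_functorD comp_linearr.
- move=> n m l k x y z.
  have [a <-] := quotient_functor_surj x; have [b <-] := quotient_functor_surj y.
  have [c <-] := quotient_functor_surj z.
  by rewrite -!quotient_functor_comp Defs.compA.
- by move=> n m l x y; rewrite !rnormE -rmorphM /= lecR comp_le.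
- move=> n m c x y.
  have [a <-] := quotient_functor_surj x; have [b <-] := quotient_functor_surj y.
  rewrite -quotient_functorZ -quotient_functorD -!quotient_functor_star.
  by rewrite -quotient_functorZ -quotient_functorD star_antilinear.
- exact: SK.
- move=> n m l x y.
  have [a <-] := quotient_functor_surj x; have [b <-] := quotient_functor_surj y.
  by rewrite -(quotient_functor_comp a b) -!quotient_functor_star -quotient_functor_comp star_comp.
- move=> n m x; rewrite !rnormE -rmorphXn; congr (_%:C); apply/eqP.
  rewrite eq_le (le_trans (comp_le _ _ _ _ _)) ?star_eq//.
  have [a <-] := quotient_functor_surj x.
  by rewrite -quotient_functor_star -quotient_functor_comp quotient_rnorm_star_comp.
Qed.

Lemma quotient_identities : has_identities TR.
Proof.
move=> n; have [e [e1 e2]] := hI n; exists (q n n e); split=> m x.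
  by have [a <-] := quotient_functor_surj x; rewrite -quotient_functor_comp e1.
by have [a <-] := quotient_functor_surj x; rewrite -quotient_functor_comp e2.
Qed.

(** Closedness is where [N] inside [K] enters: a small lift [z] of the class of [a - b] differs from
    [a - b] by an element of [K], so [a - z] lies in [K] near [a]. *)
Lemma quotient_family_ideal (K : hom_family T) : is_ideal K ->
  (forall n m, subspace_set (N n m) `<=` K n m) -> is_ideal (quotient_family N K).
Proof.
move=> hK NK; split.
- move=> n m; split; first by exists 0; [exact: (ideal0 hK)|exact/quotient_functor_eq0/(ideal0 hN)].
  move=> c _ _ [a Ka <-] [b Kb <-]; exists (c *: a + b).
    by apply: (idealD hK) => //; exact: (idealZ hK).
  by rewrite quotient_functorD quotient_functorZ.
- move=> n m; apply/closedP => x hx; have [a ax] := quotient_functor_surj x.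
  exists a => //; apply: (ideal_limit hK) => e e0.
  have [_ [b Kb <-]] := hx e e0; rewrite -ax => ab.
  have /quotient_lift[z zE ze] : rnorm (q n m (a - b)) < e.
    by move: ab; rewrite /quotient_functor quotient_mapB.
  exists (a - z); last by rewrite subKr.
  have Kabz : K n m (z - (a - b)) by apply: NK; exact/quotient_functorP.
  have -> : a - z = b - (z - (a - b)) by rewrite opprB addrCA addrA subrK.
  exact: (idealB hK).
- move=> n m l x y [b Kb <-]; have [a <-] := quotient_functor_surj x.
  by exists (a ** b); [exact: (ideal_compl hK)|rewrite quotient_functor_comp].
- move=> n m l x y [a Ka <-]; have [b <-] := quotient_functor_surj y.
  by exists (a ** b); [exact: (ideal_compr hK)|rewrite quotient_functor_comp].
Qed.

Section tensoring.
Hypothesis hTe : is_right_tensoring T.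
Hypothesis tN : forall n m (a : T n m),
  subspace_set (N n m) a -> subspace_set (N n.+1 m.+1) (tens a).

Lemma tensB n m (a b : T n m) : tens (a - b) = tens a - tens b.
Proof.
by have := tens_linear hTe (-1) b a; rewrite !scaleN1r addrC => ->; rewrite addrC.
Qed.

Lemma quotient_functor_tens n m (a : T n m) : q n.+1 m.+1 (tens a) = tens (q n m a).
Proof.
apply/esym/quotient_functorP; rewrite -tensB.
exact/tN/quotient_repr.
Qed.

Lemma quotient_tensoring : is_right_tensoring TR.
Proof.
split.
- move=> n m c x y.
  have [a <-] := quotient_functor_surj x; have [b <-] := quotient_functor_surj y.
  rewrite -quotient_functorZ -quotient_functorD -!quotient_functor_tens.
  by rewrite -quotient_functorZ -quotient_functorD tens_linear.
- move=> n m l x y.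
  have [a <-] := quotient_functor_surj x; have [b <-] := quotient_functor_surj y.
  by rewrite -!(quotient_functor_comp, quotient_functor_tens) tens_comp.
- move=> n m x; have [a <-] := quotient_functor_surj x.
  by rewrite -!(quotient_functor_star, quotient_functor_tens) tens_star.
Qed.

Lemma quotient_right_tensor_functor : is_right_tensor_functor q.
Proof.
split.
- by move=> *; rewrite quotient_functorD quotient_functorZ.
- exact: quotient_functor_comp.
- exact: quotient_functor_star.
- exact: quotient_functor_tens.
Qed.

End tensoring.
End quotients.
End precategory_theory.

(** * Continuity of the tensoring, preimages and annihilators of ideals *)

Section tensor_category_theory.
Local Open Scope complex_scope.
Variables (R : realType) (T : tensor_data R).
Hypothesis hT : is_right_tensor_cstar_category T.
Let hP := category_precategory hT.
Let hI := category_identities hT.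
Let hTe := category_tensoring hT.

Lemma tens0 n m : tens (0 : T n m) = 0.
Proof. by have := tensB hTe (0 : T n m) 0; rewrite !subrr. Qed.

(** Automatic continuity: a *-homomorphism on each diagonal algebra is contractive, and the
    C*-identity extends this to all morphisms. *)
Lemma rnorm_tens n m (a : T n m) : rnorm (tens a) <= rnorm a.
Proof.
suff h i (b : T i i) : rnorm (tens b) <= rnorm b.
  rewrite -(@ler_pXn2r _ 2) ?nnegrE ?rnorm_ge0// -!(rnorm_star_comp hP).
  by rewrite -(tens_star hTe) -(tens_comp hTe) h.
apply: (@star_hom_contractive R (endo_algebra hP i) (endo_algebra hP i.+1)
  setT (@tens R T i i)) => //.
- by move=> c x y _ _; exact: (tens_linear hTe).
- by move=> x y _ _; exact: (tens_comp hTe).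
- by move=> x _; exact: (tens_star hTe).
Qed.

Lemma family_cap_ideal (K L : hom_family T) :
  is_ideal K -> is_ideal L -> is_ideal (family_cap K L).
Proof.
move=> hK hL; split.
- move=> n m; split; first by split; [exact: (ideal0 hK)|exact: (ideal0 hL)].
  move=> c u v [Ku Lu] [Kv Lv]; have [_ KD] := ideal_subspace hK n m.
  by have [_ LD] := ideal_subspace hL n m; split; [exact: KD|exact: LD].
- by move=> n m; apply: closedI; exact: ideal_closed.
- by move=> n m l a b [Kb Lb]; split; [exact: (ideal_compl hK)|exact: (ideal_compl hL)].
- by move=> n m l a b [Kb Lb]; split; [exact: (ideal_compr hK)|exact: (ideal_compr hL)].
Qed.

Lemma tens_preimage_ideal (K : hom_family T) : is_ideal K -> is_ideal (tens_preimage K).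
Proof.
move=> hK; split; rewrite /tens_preimage /=.
- move=> n m; split=> /= [|c u v Ku Kv]; first by rewrite tens0; exact: (ideal0 hK).
  by rewrite (tens_linear hTe); have [_ KD] := ideal_subspace hK n.+1 m.+1; exact: KD.
- move=> n m; apply/closedP => a ha /=; apply: (ideal_limit hK) => e /ha[b /= Kb ab].
  by exists (tens b) => //; rewrite -(tensB hTe) (le_lt_trans (rnorm_tens _)).
- by move=> n m l a b /= Kb; rewrite (tens_comp hTe); exact: (ideal_compl hK).
- by move=> n m l a b /= Kb; rewrite (tens_comp hTe); exact: (ideal_compr hK).
Qed.

Lemma family_zero_ideal : is_ideal (@family_zero R T).
Proof.
split.
- by move=> n m; split => // c u v -> ->; rewrite scaler0 addr0.
- move=> n m; apply/closedP => a ha /=; apply: rnorm_small => e /ha[_ ->].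
  by rewrite subr0 => /ltW.
- by move=> n m l a b ->; rewrite (comp0r hP).
- by move=> n m l a b ->; rewrite (comp0l hP).
Qed.

Lemma ker_tens_ideal : is_ideal (ker_tens T).
Proof. exact/tens_preimage_ideal/family_zero_ideal. Qed.

Lemma is_annihilator_ideal (I : hom_family T) : is_ideal I ->
  is_annihilator I (fun n m => [set a : T n m | forall b, I m m b -> a ** b = 0]).
Proof.
move=> hI'; split => //; split.
- move=> n m; split=> /= [b _|c u v hu hv b Ib]; first by rewrite (comp0l hP).
  by rewrite (comp_linearl hP) hu// hv// scaler0 addr0.
- move=> n m; apply/closedP => a ha /= b Ib; apply: rnorm_small => e e0.
  have b1 : 0 < rnorm b + 1 by rewrite ltr_wpDl ?rnorm_ge0.
  have [c /= hc ac] := ha _ (divr_gt0 e0 b1).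
  have -> : a ** b = (a - c) ** b by rewrite (compBl hP) hc// subr0.
  apply: le_trans (rnorm_comp hP _ _) _; move: ac; rewrite ltr_pdivlMr// => ac.
  have := rnorm_ge0 (a - c); have := rnorm_ge0 b.
  by move: (rnorm b) (rnorm (a - c)) ac => s t; nra.
- by move=> n m l a b hb c Ic; rewrite -(Defs.compA hP) hb// (comp0r hP).
(* With [d = c ** b] in the ideal, [a ** d] times its adjoint contains [a ** (d ** star d)], and
   [d ** star d] is an element of [I m m], killed by [a]. *)
- move=> n m l a c ha b Ib; apply: (comp_star_eq0 hP).
  rewrite -(Defs.compA hP a c b); set d := c ** b.
  rewrite (star_comp hP) (Defs.compA hP) -(Defs.compA hP a d) ha ?(comp0l hP)//.
  by apply/(ideal_compr hI')/(ideal_compl hI').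
Qed.

Definition ideal_subspaces (K : hom_family T) (hK : is_ideal K) n m : closed_subspace (T n m) :=
  ClosedSubspace (ideal_subspace hK n m) (@ideal_closed _ _ _ hK n m).

Lemma quotient_star_hom (K : hom_family T) (hK : is_ideal K) n :
  @is_star_hom R (endo_algebra hP n)
    (endo_algebra (@quotient_precategory R T hP hI (ideal_subspaces hK) hK) n)
    (quotient_functor (ideal_subspaces hK) n n).
Proof.
split.
- by move=> c x y; rewrite quotient_functorD quotient_functorZ.
- by move=> x y; exact: (quotient_functor_comp hP (N := ideal_subspaces hK)).
- by move=> x; exact: (quotient_functor_star hP hI (N := ideal_subspaces hK)).
Qed.

Lemma tens_star_hom n : @is_star_hom R (endo_algebra hP n) (endo_algebra hP n.+1) (@tens R T n n).
Proof.
split; [exact: (tens_linear hTe)|exact: (tens_comp hTe)|exact: (tens_star hTe)].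
Qed.

(** * The reduction steps and the reduction ideal *)

Section reductions.
Variable J : hom_family T.
Hypothesis hJ : is_ideal J.
Arguments J : clear implicits.

Lemma reduction_step_props k :
  [/\ is_ideal (reduction_step J k), subfamily (reduction_step J k) J &
    forall n m (a : T n m), reduction_step J k n m a -> reduction_step J k n.+1 m.+1 (tens a)].
Proof.
elim: k => [|k [IH1 IH2 IH3]].
  split; first exact: family_zero_ideal.
    by move=> n m a ->; exact: (ideal0 hJ).
  by move=> n m a ->; exact: tens0.
(* The second summand is contained in the first, so the sum is an intersection; this makes it
   closed. *)
have E : reduction_step J k.+1 = family_cap J (tens_preimage (reduction_step J k)).
  apply: functional_extensionality_dep => n; apply: functional_extensionality_dep => m.
  apply/seteqP; split=> [_ [a Sa [b Sb <-]]|a Sa].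
    apply: (idealD (family_cap_ideal hJ (tens_preimage_ideal IH1))) => //.
    by split; [exact: IH2|exact: IH3].
  by exists a => //; exists 0; [exact: (ideal0 IH1)|rewrite addr0].
rewrite E; split.
- exact/family_cap_ideal/tens_preimage_ideal.
- by move=> n m a [].
- by move=> n m a [Ja Sa]; split; [exact: IH2|exact: IH3].
Qed.

Lemma reduction_ideal_is_ideal : is_ideal (reduction J).
Proof.
have near n m (a : T n m) : reduction J n m a -> forall e : R, 0 < e ->
    exists k, exists2 b, reduction_step J k n m b & rnorm (a - b) < e.
  by move=> /closure_rnorm h e /h[b [k _ Sb] ab]; exists k, b.
split.
- exact: reduction_subspaceP hT _ hJ.
- by move=> n m; exact: closed_closure.
- move=> n m l a b /near hb; apply/closure_rnorm => e e0.
  have a1 : 0 < rnorm a + 1 by rewrite ltr_wpDl ?rnorm_ge0.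
  have [k [c Sc bc]] := hb _ (divr_gt0 e0 a1).
  have [Sk _ _] := reduction_step_props k.
  exists (a ** c); first by exists k => //; exact: (ideal_compl Sk).
  rewrite -(compBr hP) (le_lt_trans (rnorm_comp hP _ _))//.
  move: bc; rewrite ltr_pdivlMr//; have := rnorm_ge0 (b - c); have := rnorm_ge0 a.
  by move: (rnorm a) (rnorm (b - c)) => s t; nra.
- move=> n m l a b /near ha; apply/closure_rnorm => e e0.
  have b1 : 0 < rnorm b + 1 by rewrite ltr_wpDl ?rnorm_ge0.
  have [k [c Sc ac]] := ha _ (divr_gt0 e0 b1).
  have [Sk _ _] := reduction_step_props k.
  exists (c ** b); first by exists k => //; exact: (ideal_compr Sk).
  rewrite -(compBl hP) (le_lt_trans (rnorm_comp hP _ _))//.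
  move: ac; rewrite ltr_pdivlMr//; have := rnorm_ge0 (a - c); have := rnorm_ge0 b.
  by move: (rnorm b) (rnorm (a - c)) => s t; nra.
Qed.

Lemma reduction_step_reduction k n m (a : T n m) :
  reduction_step J k n m a -> reduction J n m a.
Proof. by move=> Sa; apply: subset_closure; exists k. Qed.

Lemma reduction_sub : subfamily (reduction J) J.
Proof.
move=> n m a /closure_rnorm ha; apply: (ideal_limit hJ) => e /ha[b [k _ Sb] ab].
by exists b => //; have [_ + _] := reduction_step_props k; apply.
Qed.

Lemma reduction_tens n m (a : T n m) : reduction J n m a -> reduction J n.+1 m.+1 (tens a).
Proof.
move=> /closure_rnorm ha; apply/closure_rnorm => e /ha[b [k _ Sb] ab].
exists (tens b); last by rewrite -(tensB hTe) (le_lt_trans (rnorm_tens _)).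
by exists k => //; have [_ _] := reduction_step_props k; apply.
Qed.

(** The image under the tensoring is only close to some [S_k], whereas [S_(k+1)] demands that it lie
    in [S_k]; [truncation] trades the small error for a small change of the element. *)
Lemma reduction_tens_inv n m (a : T n m) : J n m a ->
  reduction J n.+1 m.+1 (tens a) -> reduction J n m a.
Proof.
move=> Ja Ra; have hR := reduction_ideal_is_ideal.
apply: (ideal_of_star_comp hP hI hR); set t := star a ** a.
have st : star t = t by rewrite (star_comp hP) (starK hP).
(* A second squaring yields [t ** t] with [t] self-adjoint, the form that [truncation] takes. *)
apply: (ideal_of_star_comp hP hI hR); rewrite st.
have Jt : J m m (t ** t) by apply/(ideal_compl hJ)/(ideal_compl hJ).
have : reduction J m.+1 m.+1 (tens (t ** t)).
  by rewrite !(tens_comp hTe); do 2 apply: (ideal_compl hR).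
move=> /closure_rnorm Rt; apply: (ideal_limit hR) => e e0.
(* The truncation moves [t ** t] by at most twice its threshold, here [e / 2]. *)
have e4 : 0 < e / 4%:R by rewrite divr_gt0.
have [y [k _ Sy] ty] := Rt _ e4.
have [u [u1 u2]] := hI m.
have [c tc fc] := @truncation R (endo_algebra hP m) u t (e / 4%:R)
  (fun a => conj (u1 _ a) (u2 _ a)) st e4.
have {}tc : rnorm (t ** t - c) <= 2%:R * (e / 4%:R) := tc.
exists c; last by lra.
have [Sk _ _] := reduction_step_props k.
apply: (@reduction_step_reduction k.+1); exists c; last first.
  by exists 0; [exact: (ideal0 Sk)|rewrite addr0].
split.
  apply/(quotient_functor_eq0 (ideal_subspaces hJ)).
  apply: (fc _ _ (quotient_star_hom hJ m)).
  have -> : quotient_functor (ideal_subspaces hJ) m m (t ** t) = 0.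
    exact/(quotient_functor_eq0 (ideal_subspaces hJ)).
  by rewrite rnorm0 ltW.
apply/(quotient_functor_eq0 (ideal_subspaces Sk)).
pose Q := endo_algebra (@quotient_precategory R T hP hI (ideal_subspaces Sk) Sk) m.+1.
pose f (b : endo_algebra hP m) : Q := quotient_functor (ideal_subspaces Sk) _ _ (tens b).
apply: (fc Q f).
  have [qL qM qS] := quotient_star_hom Sk m.+1; have [tL tM tS] := tens_star_hom m.
  by split=> *; rewrite /f ?(tL, tM, tS) ?(qL, qM, qS).
(* Subtracting [y] from [S_k] does not change the class and brings the norm below the threshold. *)
have -> : f (t ** t) = quotient_functor (ideal_subspaces Sk) _ _ (tens (t ** t) - y).
  by apply/(quotient_functorP (ideal_subspaces Sk)); rewrite subKr.
apply: le_trans (rnorm_quotient_functor _ _) _; exact: ltW.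
Qed.

End reductions.

(** * Contractivity of representations and their vanishing on the reduction ideal *)

Section representations.
Variables (K : hom_family T) (B : cstar_algebra R) (pi : forall n m, T n m -> B).
Arguments K : clear implicits.
Arguments pi : clear implicits.
Hypotheses (hK : is_ideal K) (hpi : is_representation K pi).

Lemma rep0 n m : pi n m 0 = 0.
Proof.
have K0 := ideal0 hK n m; have := rep_linear hpi (-1) K0 K0.
by rewrite scaler0 addr0 scaleN1r addNr.
Qed.

Lemma repD n m (a b : T n m) : K n m a -> K n m b -> pi n m (a + b) = pi n m a + pi n m b.
Proof. by move=> Ka Kb; have := rep_linear hpi 1 Ka Kb; rewrite !scale1r. Qed.

(** [rep_mul] with [k = 0] makes [pi] a *-homomorphism on the closed subalgebra [K i i]; the
    C*-identity handles the other morphisms. *)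
Lemma rep_contractive n m (a : T n m) : K n m a -> rnorm (pi n m a) <= rnorm a.
Proof.
move=> Ka; suff h i (b : T i i) : K i i b -> rnorm (pi i i b) <= rnorm b.
  rewrite -(@ler_pXn2r _ 2) ?nnegrE ?rnorm_ge0// -(rnorm_star_comp hP) -rnorm_cstar.
  have Ksa : K m n (star a) by exact: (ideal_star hP hI hK).
  rewrite (rep_star hpi)// (rep_mul (k := 0) hpi)//=.
  by apply: h; exact: (ideal_compl hK).
apply: (@star_hom_contractive R (endo_algebra hP i) B (K i i) (pi i i)) => //.
- split; [exact: (ideal_subspace hK)|exact: (ideal_closed hK)| |].
    by move=> x y _ Ky; exact: (ideal_compl hK).
  by move=> x; exact: (ideal_star hP hI hK).
- by move=> c x y Kx Ky; exact: (rep_linear hpi).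
- by move=> x y Kx Ky; rewrite (rep_mul (k := 0) hpi).
- by move=> x Kx; rewrite (rep_star hpi).
Qed.

(** For [u] in [J] with [tens u] in [S_k], coisometry gives [pi u = pi (tens u)], which vanishes by
    induction; contractivity passes to the closure. *)
Lemma rep_reduction J : is_ideal J -> subfamily J K -> is_coisometric J pi ->
  forall n m (a : T n m), reduction J n m a -> pi n m a = 0.
Proof.
move=> hJ JK cpi.
have step k : forall n m (a : T n m), reduction_step J k n m a -> pi n m a = 0.
  elim: k => [|k IH] n m a; first by move=> ->; exact: rep0.
  move=> [u [Ju Su] [v Sv <-]]; have [_ SJ _] := reduction_step_props hJ k.
  rewrite repD ?(IH _ _ v)//; first by rewrite cpi// (IH _ _ _ Su) addr0.
    exact: JK.
  exact/JK/SJ.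
move=> n m a Ra; have Ka : K n m a by apply/JK/(reduction_sub hJ).
move/closure_rnorm in Ra; apply: rnorm_small => e /Ra[b [k _ Sb] ab].
have [_ SJ _] := reduction_step_props hJ k; have Kb : K n m b by exact/JK/SJ.
have Kab : K n m (a - b) by exact: (idealB hK).
rewrite -(subrK b a) repD// (step k _ _ b)// addr0.
by apply: le_trans (rep_contractive Kab) _; exact: ltW.
Qed.

End representations.
End tensor_category_theory.

(** * Uniqueness for universal algebras and pullback of representations *)

Section universal_algebras.
Variable R : realType.

Lemma star_hom_lipschitz (A B : cstar_algebra R) (f : A -> B) : is_star_hom f ->
  forall x y, rnorm (f x - f y) <= 1 * rnorm (x - y).
Proof.
move=> [fL fM fS] x y; rewrite mul1r.
have -> : f x - f y = f (x - y).
  by have := fL (-1) y x; rewrite !scaleN1r [- y + x]addrC => ->; rewrite addrC.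
apply: (@star_hom_contractive R A B setT f) => //.
Qed.

Lemma star_hom_comp (A B C : cstar_algebra R) (f : A -> B) (g : B -> C) :
  is_star_hom f -> is_star_hom g -> is_star_hom (fun x => g (f x)).
Proof. by move=> [fL fM fS] [gL gM gS]; split=> *; rewrite ?(fL, fM, fS) ?(gL, gM, gS). Qed.

(** [universal_factor] asserts existence only; uniqueness comes from generation, as the fixed points
    of [h] form a C*-subalgebra. *)
Lemma universal_algebra_endo (T : tensor_data R) (K J : hom_family T) (B : cstar_algebra R)
  (i : forall n m, T n m -> B) (h : B -> B) :
  is_universal_algebra K J i -> is_star_hom h ->
  (forall n m (a : T n m), K n m a -> h (i n m a) = i n m a) -> forall b, h b = b.
Proof.
move=> uB hh hi b; have hL := star_hom_lipschitz hh; have [hl hm hs] := hh.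
suff E : [set b | h b = b] = setT by rewrite -[_ = _]/([set b | h b = b] b) E.
apply: (universal_generated uB); last exact: hi.
have h0 : h 0 = 0 by apply: (addrI (h 0)); have := hl 1 0 0; rewrite !scale1r !addr0.
split => /=.
- by split=> //= c u v hu hv; rewrite hl hu hv.
- by apply: (closed_lipschitz_eq (M := 1)) => // x y; rewrite mul1r.
- by move=> x y hx hy; rewrite hm hx hy.
- by move=> x hx; rewrite hs hx.
Qed.

Lemma functor_tens_iter (T T' : tensor_data R) (q : forall n m, T n m -> T' n m) :
  is_right_tensor_functor q -> forall n m k (a : T n m),
  q _ _ (tens_iter k a) = tens_iter k (q n m a).
Proof. by move=> hq n m k a; elim: k => //= k <-; rewrite (functor_tens hq). Qed.

Lemma representation_comp (T T' : tensor_data R) (q : forall n m, T n m -> T' n m)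
  (K : hom_family T) (K' : hom_family T') (B : cstar_algebra R) (pi : forall n m, T' n m -> B) :
  is_right_tensor_functor q -> (forall n m (a : T n m), K n m a -> K' n m (q n m a)) ->
  is_representation K' pi -> is_representation K (fun n m a => pi n m (q n m a)).
Proof.
move=> hq hK hpi; split.
- by move=> n m c a b Ka Kb; rewrite (functor_linear hq) (rep_linear hpi)//; exact: hK.
- by move=> n m a Ka; rewrite (functor_star hq) (rep_star hpi)//; exact: hK.
- move=> n m k l a b Ka Kb; rewrite (functor_comp hq) (functor_tens_iter hq).
  by rewrite (rep_mul hpi)//; exact: hK.
Qed.

End universal_algebras.

(** * Descent of coisometric representations to the quotient *)

Section representation_lift.
Variables (R : realType) (T : tensor_data R).
Hypothesis hT : is_right_tensor_cstar_category T.
Variables (K J : hom_family T).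
Hypotheses (hK : is_ideal K) (hJ : is_ideal J) (JK : subfamily J K).
Variables (B : cstar_algebra R) (pi : forall n m, T n m -> B).
Arguments K : clear implicits.
Arguments J : clear implicits.
Arguments pi : clear implicits.
Hypotheses (hpi : is_representation K pi) (cpi : is_coisometric J pi).
Let N := reduction_ideal hT hJ.
Let hN : is_ideal (fun n m => subspace_set (N n m)) := reduction_ideal_is_ideal hT hJ.
Let hP := category_precategory hT.
Let hI := category_identities hT.

Let lift n m (x : quotient_data N n m) : B := pi n m (repr x).

(** The chosen representative differs from [a] by an element of the reduction ideal, which lies in
    [K] and is killed by [pi]. *)
Lemma lift_quotient n m (a : T n m) : K n m a -> lift (quotient_functor N n m a) = pi n m a.
Proof.
move=> Ka; have Nr := quotient_repr N a; rewrite /lift; set r := repr _ in Nr *.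
have Kr : K n m (r - a) by apply/JK/(reduction_sub hT hJ).
rewrite -[r](subrK a) (repD hpi)//.
by rewrite (rep_reduction hT hK hpi hJ JK cpi Nr) add0r.
Qed.

Let hq : is_right_tensor_functor (quotient_functor N).
Proof.
exact: (quotient_right_tensor_functor hP hI hN (category_tensoring hT)
  (@reduction_tens _ _ hT _ hJ)).
Qed.

Lemma lift_representation : is_representation (quotient_family N K) (@lift).
Proof.
split.
- move=> n m c _ _ [a Ka <-] [b Kb <-]; rewrite -(functor_linear hq) !lift_quotient//.
    exact: (rep_linear hpi).
  by apply: (idealD hK) => //; exact: (idealZ hK).
- move=> n m _ [a Ka <-]; rewrite -(functor_star hq) !lift_quotient//.
    exact: (rep_star hpi).
  exact: (ideal_star hP hI hK).
- move=> n m k l _ _ [a Ka <-] [b Kb <-].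
  rewrite -(functor_tens_iter hq) -(functor_comp hq) !lift_quotient//.
    exact: (rep_mul hpi).
  exact: (ideal_compl hK).
Qed.

Lemma lift_coisometric : subfamily J (tens_preimage K) ->
  is_coisometric (quotient_family N J) (@lift).
Proof.
move=> JtK n m _ [a Ja <-]; rewrite -(functor_tens hq) !lift_quotient.
- exact: cpi.
- exact: JtK.
- exact: JK.
Qed.

End representation_lift.

Theorem theorem6p11 (R : realType) (T : tensor_data R)
    (hT : is_right_tensor_cstar_category T)
    (K J : hom_family T) (hK : is_ideal K) (hJ : is_ideal J)
    (hJK : subfamily J (tensor_part K)) :
  let N := reduction_ideal hT hJ in
  let TR := quotient_data N in
  let q := quotient_functor N in
  let KR : hom_family TR := quotient_family N K in
  let JR : hom_family TR := quotient_family N J in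
  [/\ is_right_tensor_cstar_category TR,
      is_right_tensor_functor q,
      is_ideal KR /\ is_ideal JR,
      subfamily JR (family_cap (tensor_part KR) (annihilator (ker_tens TR)))
    & forall (B : cstar_algebra R) (i : forall n m, T n m -> B)
             (BR : cstar_algebra R) (iR : forall n m, TR n m -> BR),
        is_universal_algebra K J i -> is_universal_algebra KR JR iR ->
        exists f : B -> BR,
          [/\ is_star_hom f, bijective f &
              forall n m (a : T n m), K n m a ->
                f (i n m a) = iR n m (q n m a)]].
Proof.
move=> N TR q KR JR.
have [hP hI hTe] := hT.
have hN : is_ideal (fun n m => subspace_set (N n m)) := reduction_ideal_is_ideal hT hJ.
have tN : forall n m (a : T n m),
    subspace_set (N n m) a -> subspace_set (N n.+1 m.+1) (tens a) := @reduction_tens _ _ hT _ hJ.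
have JK : subfamily J K by move=> n m a /hJK[].
have JtK : subfamily J (tens_preimage K) by move=> n m a /hJK[].
have hTR : is_right_tensor_cstar_category TR.
  split.
  - exact: (quotient_precategory hP hI hN).
  - exact: (quotient_identities hP hI hN).
  - exact: (quotient_tensoring hP hI hN hTe tN).
have hq : is_right_tensor_functor q := quotient_right_tensor_functor hP hI hN hTe tN.
have hKR : is_ideal KR.
  by apply: (quotient_family_ideal hP hN hK) => n m a Na; exact/JK/(reduction_sub hT hJ).
have hJR : is_ideal JR.
  by apply: (quotient_family_ideal hP hN hJ) => n m a Na; exact/(reduction_sub hT hJ).
split => //.
- move=> n m _ [a Ja <-]; split.
    split; first by exists a => //; exact: JK.
    exists (tens a); first exact: JtK.
    exact: (functor_tens hq a).
  exists (fun n m => [set x : TR n m | forall y, ker_tens TR m m y -> x ** y = 0]).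
    exact/(is_annihilator_ideal hTR)/(ker_tens_ideal hTR).
  move=> y; have [b <- tb] := quotient_functor_surj y.
  have /(quotient_functor_eq0 N) Nb : q _ _ (tens b) = 0 by rewrite (functor_tens hq).
  rewrite -/(q n m a) -(functor_comp hq).
  (* [a ** b] lies in [J] and its tensoring in the reduction ideal, because [tens b] does; hence
     [a ** b] itself is in that ideal. *)
  apply/(quotient_functor_eq0 N)/(reduction_tens_inv hT hJ).
    exact: (ideal_compr hJ).
  by rewrite (tens_comp hTe); exact: (ideal_compl hN).
- move=> B i BR iR uB uBR.
  have [ri ci] := (universal_rep uB, universal_coisometric uB).
  have [rR cR] := (universal_rep uBR, universal_coisometric uBR).
  have qK n m (a : T n m) : K n m a -> KR n m (q n m a) by exists a.
  (* [f] comes from pulling [iR] back along [q], [g] from descending [i] to the quotient; both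
     composites fix the generators. *)
  have [f hf fi] := universal_factor uB (representation_comp hq qK rR)
    (fun n m a Ja => etrans (cR n m (q n m a) (ex_intro2 _ _ a Ja erefl))
      (congr1 (iR n.+1 m.+1) (esym (functor_tens hq a)))).
  have [g hg gi] := universal_factor uBR (lift_representation hT hK hJ JK ri ci)
    (@lift_coisometric _ _ hT _ _ hK hJ JK _ _ ri ci JtK).
  exists f; split => //; exists g.
    apply: (universal_algebra_endo uB (star_hom_comp hf hg)) => n m a Ka.
    by rewrite fi// gi ?(lift_quotient hT hK hJ JK ri ci)//; exact: qK.
  apply: (universal_algebra_endo uBR (star_hom_comp hg hf)) => n m _ [a Ka <-].
  rewrite gi; last exact: qK.
  by rewrite (lift_quotient hT hK hJ JK ri ci)// fi.
Qed.
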